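(* Let $C_w$ be a cell of $\mathcal{SG}$ with $C_w\cap V_0=\emptyset$ and boundary points $p_i=F_wq_i$, $i=0,1,2$. For every $(a_0,a_1,a_2)\in\mathbb{R}^3$ with $a_i\ge0$ and $a_0+a_1+a_2=1$ there exist $c_0,c_1,c_2\in[0,1]$ such that $$M_{B(c_0,c_1,c_2)}(h)=a_0h(p_0)+a_1h(p_1)+a_2h(p_2)$$ for every harmonic function $h$ on $\mathcal{SG}$.
   Context: Let $q_0,q_1,q_2$ be the vertices of an equilateral triangle in $\mathbb{R}^2$ and $F_i(z)=\frac12(z+q_i)$. The Sierpinski gasket $\mathcal{SG}$ is the unique nonempty compact set with $\mathcal{SG}=\bigcup_{i=0}^2F_i(\mathcal{SG})$. For $w\in\{0,1,2\}^m$, $F_w=F_{w_1}\circ\cdots\circ F_{w_m}$ and $C_w=F_w(\mathcal{SG})$ is an $m$-cell. $V_0=\{q_0,q_1,q_2\}$, $V_m=\bigcup_{|w|=m}F_w(V_0)$, and $x\sim_m y$ means $x\ne y$ lie in a common $F_w(V_0)$, $|w|=m$. $\mu$ is the self-similar probability measure giving mass $3^{-m}$ to each $m$-cell. A continuous $h:\mathcal{SG}\to\mathbb{R}$ is harmonic if $h(x)=\frac14\sum_{y\sim_mx}h(y)$ for all $m\ge1$, $x\in V_m\setminus V_0$. $M_B(h)=\frac1{\mu(B)}\int_Bh\,d\mu$. For $C_w$ as in the claim, $C_i$ denotes the unique other cell of the same level containing $p_i$, $\rho$ is the height of the triangle $F_w(\mathrm{conv}\,V_0)$, and for $c_i\in[0,1]$,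 with $u_i$ the unit vector at $p_i$ along the symmetry axis of the triangle of $C_i$ pointing into $C_i$, $E_i=\{z\in C_i:\langle z-p_i,u_i\rangle\le c_i\rho\}$ (the sub-triangle of $C_i$ cut off symmetrically by a line at distance $c_i\rho$ from $p_i$), and $B(c_0,c_1,c_2)=C_w\cup E_0\cup E_1\cup E_2$. *)

(* Defs.v *)
From HB Require Import structures.
From mathcomp Require Import all_boot all_order all_algebra.
From mathcomp Require Import all_classical all_reals all_analysis.
Set Implicit Arguments. Unset Strict Implicit. Unset Printing Implicit Defensive.
Import Order.TTheory GRing.Theory Num.Theory numFieldNormedType.Exports.
Local Open Scope ring_scope.
Local Open Scope classical_set_scope.

Definition dotp (R : realType) (u v : R * R) : R := u.1 * v.1 + u.2 * v.2.
Definition subp (R : realType) (u v : R * R) : R * R := (u.1 - v.1, u.2 - v.2).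
Definition scalep (R : realType) (k : R) (u : R * R) : R * R := (k * u.1, k * u.2).
Definition normp (R : realType) (u : R * R) : R := Num.sqrt (dotp u u).
Definition midp (R : realType) (u v : R * R) : R * R := ((u.1 + v.1) / 2, (u.2 + v.2) / 2).

Definition i0 : 'I_3 := @Ordinal 3 0 isT.
Definition i1 : 'I_3 := @Ordinal 3 1 isT.
Definition i2 : 'I_3 := @Ordinal 3 2 isT.

Definition equilateral (R : realType) (q : 'I_3 -> R * R) : Prop :=
  let d u v := dotp (subp u v) (subp u v) in
  d (q i0) (q i1) = d (q i1) (q i2) /\ d (q i1) (q i2) = d (q i0) (q i2)
  /\ 0 < d (q i0) (q i1).

Definition Fmap (R : realType) (q : 'I_3 -> R * R) (i : 'I_3) (z : R * R) : R * R :=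
  midp z (q i).

Definition Fword (R : realType) (q : 'I_3 -> R * R) (w : seq 'I_3) : R * R -> R * R :=
  foldr (fun i g => Fmap q i \o g) id w.

Definition is_SG (R : realType) (q : 'I_3 -> R * R) (K : set (R * R)) : Prop :=
  @compact (R * R)%type K /\ K !=set0 /\ K = \bigcup_i (Fmap q i @` K).

Definition cell (R : realType) (q : 'I_3 -> R * R) (K : set (R * R)) (w : seq 'I_3)
  : set (R * R) := Fword q w @` K.

Definition SG_measure (R : realType) (q : 'I_3 -> R * R) (K : set (R * R))
  (mu : {measure set (R * R)%type -> \bar R}) : Prop :=
  mu setT = 1%E /\ mu (~` K) = 0%E /\
  forall w : seq 'I_3, mu (cell q K w) = ((3%:R : R) ^- size w)%:E.

Definition Vm (R : realType) (q : 'I_3 -> R * R) (m : nat) : set (R * R) :=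
  [set x | exists (w : seq 'I_3) (i : 'I_3), size w = m /\ x = Fword q w (q i)].

Definition nbrs (R : realType) (q : 'I_3 -> R * R) (m : nat) (x : R * R) : seq (R * R) :=
  undup (flatten
    [seq [seq Fword q (val t) (q j) | j <- enum 'I_3 &
            [exists k : 'I_3, x == Fword q (val t) (q k)]
            && (x != Fword q (val t) (q j))]
    | t <- enum {: m.-tuple 'I_3}]).

Definition SG_harmonic (R : realType) (q : 'I_3 -> R * R) (K : set (R * R))
  (h : R * R -> R) : Prop :=
  {within K, continuous h} /\
  forall (m : nat) (x : R * R), (1 <= m)%N -> Vm q m x -> ~ range q x ->
    h x = 4^-1 * \sum_(y <- nbrs q m x) h y.

Definition meanval (R : realType) (mu : {measure set (R * R)%type -> \bar R})
  (B : set (R * R)) (h : R * R -> R) : R :=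
  fine (\int[mu]_(x in B) (h x)%:E) / fine (mu B).

Definition centroid (R : realType) (q : 'I_3 -> R * R) : R * R :=
  (((q i0).1 + (q i1).1 + (q i2).1) / 3, ((q i0).2 + (q i1).2 + (q i2).2) / 3).

Definition height (R : realType) (q : 'I_3 -> R * R) (w : seq 'I_3) : R :=
  normp (subp (Fword q w (q i0)) (midp (Fword q w (q i1)) (Fword q w (q i2)))).

(* E = {z in C_{w'} : <z - p, u> <= c rho}, with u the unit vector at p along the
   symmetry axis of the triangle F_{w'}(conv V0), pointing into it (towards its
   centroid) *)
Definition Ecap (R : realType) (q : 'I_3 -> R * R) (K : set (R * R))
  (w' : seq 'I_3) (p : R * R) (c rho : R) : set (R * R) :=
  let v := subp (Fword q w' (centroid q)) p in
  let u := scalep (normp v)^-1 v in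
  [set z | cell q K w' z /\ dotp (subp z p) u <= c * rho].

Definition Bset (R : realType) (q : 'I_3 -> R * R) (K : set (R * R))
  (w : seq 'I_3) (w' : 'I_3 -> seq 'I_3) (c : 'I_3 -> R) : set (R * R) :=
  cell q K w `|` \bigcup_i Ecap q K (w' i) (Fword q w (q i)) (c i) (height q w).

(* Main.v *)
Require Import Defs.
From HB Require Import structures.
From mathcomp Require Import all_boot all_order all_algebra.
From mathcomp Require Import all_classical all_reals all_analysis.
From mathcomp Require Import ring lra.
Import Order.TTheory GRing.Theory Num.Theory numFieldNormedType.Exports.
Set Implicit Arguments.
Unset Strict Implicit.
Unset Printing Implicit Defensive.
Local Open Scope ring_scope.
Local Open Scope classical_set_scope.

(* Normalise so that cells of the level of [w] have mass 1, and let [H i] be the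
   value of [h] at [p_i] and [S] the sum of the [H i]. Integrating harmonic functions
   over triangular caps by Riemann sums over subcells, the symmetry of the cap and
   the harmonicity of [h] at [p_i] give for the cap of parameter [c] the integral
   [e c * H i + b c * (3 * H i - S)], where [e c] is its mass, [e] and [b] are
   continuous and nondecreasing, [e 1 = 1], [b 1 = 1 / 3] and both vanish at 0. So one
   must solve three equations in [c_0, c_1, c_2] which only involve [e] and [b]. If
   [a_0 >= a_1 >= a_2], put [c_2 = 0], solve the second equation for [c_1] given [c_0]
   (the solution need not be unique, but [e c_1] and [b c_1] depend continuously on
   [c_0]), and solve the third by the intermediate value theorem in [c_0]: at one end
   the coefficient of [H 2] equals that of [H 1] or [H 0], at the other it is
   nonpositive. *)

(** * Harmonic extension on words and cap sums *)

Lemma big_I3 (V : nmodType) (F : 'I_3 -> V) : \sum_i F i = F i0 + F i1 + F i2.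
Proof.
rewrite !big_ord_recl big_ord0 addr0 addrA.
by congr (F _ + F _ + F _); apply/val_inj.
Qed.

Lemma I3_case (P : 'I_3 -> Prop) : P i0 -> P i1 -> P i2 -> forall i, P i.
Proof.
move=> h0 h1 h2 [[|[|[|i]]] hi] //.
- by rewrite (_ : Ordinal hi = i0) //; exact/val_inj.
- by rewrite (_ : Ordinal hi = i1) //; exact/val_inj.
- by rewrite (_ : Ordinal hi = i2) //; exact/val_inj.
Qed.

Fixpoint words (n : nat) : seq (seq 'I_3) :=
  if n is n'.+1 then [seq a :: v | a <- enum 'I_3, v <- words n'] else [:: [::]].

Lemma mem_words n v : (v \in words n) = (size v == n).
Proof.
elim: n v => [|n IH] v /=; first by rewrite inE; case: v.
apply/allpairsP/idP => [[[a u] /= [_ hu ->]]|].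
  by move: hu; rewrite IH.
case: v => // a v hv; exists (a, v); split => //=.
- by rewrite mem_enum.
- by rewrite IH.
Qed.

Lemma uniq_words n : uniq (words n).
Proof.
elim: n => //= n IH; apply: allpairs_uniq => //; first exact: enum_uniq.
by move=> [a u] [b v] _ _ /= [-> ->].
Qed.

Lemma big_words_recl (V : nmodType) n (P : pred (seq 'I_3)) (F : seq 'I_3 -> V) :
  \sum_(v <- words n.+1 | P v) F v =
  \sum_a \sum_(v <- words n | P (a :: v)) F (a :: v).
Proof.
rewrite big_mkcond big_allpairs_dep big_enum /=.
by apply: eq_bigr => a _; rewrite [RHS]big_mkcond.
Qed.

Section Extension.
Variable R : realType.
Implicit Types (x y : 'I_3 -> R) (k a j : 'I_3) (t : R) (n : nat).

Definition mean3 x : R := (\sum_j x j) / 3.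

(* The "1/5-2/5" rule: vertex values on the subcell [F_a] of the harmonic
   function with vertex values [x]. *)
Definition subcell x a : 'I_3 -> R :=
  fun j => if j == a then x a else (x a + x j + \sum_i x i) / 5.

Fixpoint ext x (v : seq 'I_3) : 'I_3 -> R :=
  if v is a :: v' then ext (subcell x a) v' else x.

Lemma subcell_sum x a :
  \sum_j subcell x a j = (6 * x a + 3 * \sum_i x i) / 5.
Proof.
rewrite /subcell !big_I3.
by elim/I3_case: a => /=; field.
Qed.

(** Subdivision preserves the average of the vertex values, which is why [mean3] serves as the mean
    of a harmonic function over a cell at every level. *)
Lemma mean3_subcell x : \sum_a mean3 (subcell x a) = 3 * mean3 x.
Proof.
rewrite /mean3 -mulr_suml (eq_bigr _ (fun a _ => subcell_sum x a)) !big_I3.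
by field.
Qed.

Lemma subcell_ge0 x a : (forall j, 0 <= x j) -> forall j, 0 <= subcell x a j.
Proof.
move=> x0 j; rewrite /subcell; case: eqP => // _.
by rewrite divr_ge0 ?addr_ge0 ?sumr_ge0.
Qed.

Lemma subcell_le1 x a : (forall j, x j <= 1) -> forall j, subcell x a j <= 1.
Proof.
move=> x1 j; rewrite /subcell; case: eqP => // _; rewrite big_I3.
move: (x1 a) (x1 j) (x1 i0) (x1 i1) (x1 i2); lra.
Qed.

Lemma subcell_const1 a : subcell (fun=> 1) a = fun=> 1.
Proof.
by apply/funext => j; rewrite /subcell big_I3; case: eqP => // _; field.
Qed.

Lemma mean3_ge0 x : (forall j, 0 <= x j) -> 0 <= mean3 x.
Proof. by move=> x0; rewrite divr_ge0 ?sumr_ge0. Qed.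

Lemma mean3_le1 x : (forall j, x j <= 1) -> mean3 x <= 1.
Proof.
move=> x1; rewrite /mean3 big_I3.
move: (x1 i0) (x1 i1) (x1 i2); lra.
Qed.

(* [low k v] is the minimum of the [k]-th barycentric coordinate over the cell
   of the word [v]. *)
Fixpoint low k (v : seq 'I_3) : R :=
  if v is a :: v' then ((a == k)%:R + low k v') / 2 else 0.

(** Riemann sum over the level-[n] subcells on which the [k]-th barycentric coordinate is at least
    [t], for a cell of mass 1. Entering the subcell of [a] turns the threshold [t] into
    [2 * t - (a == k)%:R]. *)
Fixpoint capsum k n t x : R :=
  if n is n'.+1
  then (\sum_a capsum k n' (2 * t - (a == k)%:R) (subcell x a)) / 3
  else if t <= 0 then mean3 x else 0.

Lemma capsumE k n t x :
  capsum k n t x = 3 ^- n * \sum_(v <- words n | t <= low k v) mean3 (ext x v).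
Proof.
elim: n t x => [|n IH] t x.
  by rewrite expr0 invr1 mul1r big_cons big_nil /=; case: ifP; rewrite ?addr0.
rewrite big_words_recl /= exprS invfM -mulrA mulrC; congr (_ * _).
rewrite mulr_sumr; apply: eq_bigr => a _; rewrite IH; congr (_ * _).
apply: eq_bigl => v; rewrite ler_pdivlMr // lerBlDl.
by rewrite mulrC.
Qed.

Lemma capsum_ge0 k n t x : (forall j, 0 <= x j) -> 0 <= capsum k n t x.
Proof.
elim: n t x => [|n IH] t x x0 /=.
  by case: ifP => // _; exact: mean3_ge0.
by rewrite divr_ge0 ?sumr_ge0 // => a _; apply: IH; exact: subcell_ge0.
Qed.

Lemma capsum_full k n t x : t <= 0 -> capsum k n t x = mean3 x.
Proof.
elim: n t x => [|n IH] t x t0 /=; first by rewrite t0.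
rewrite (eq_bigr (fun a => mean3 (subcell x a))) => [|a _]; last first.
  by rewrite IH //; case: eqP => _ /=; lra.
by rewrite mean3_subcell; field.
Qed.

Lemma halfX n : (2 ^- n.+1 : R) * 2 = 2 ^- n.
Proof. by rewrite exprS invfM mulrAC mulVf ?mul1r. Qed.

(** For a word [v] of length [n], [low k v] is at most [1 - 2 ^- n], with equality at the corner
    [k], so no subcell is selected. *)
Lemma capsum_empty k n t x : 1 < t + 2 ^- n -> capsum k n t x = 0.
Proof.
elim: n t x => [|n IH] t x tn.
  by rewrite /= leNgt; case: ifP => //; move: tn; rewrite expr0 invr1; lra.
rewrite /= big1 ?mul0r // => a _; apply: IH.
by have := halfX n; case: eqP => _ /=; lra.
Qed.

Lemma capsum_nincr k n t t' x : (forall j, 0 <= x j) -> t <= t' ->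
  capsum k n t' x <= capsum k n t x.
Proof.
elim: n t t' x => [|n IH] t t' x x0 tt' /=.
  case: ifP => h; first by rewrite (le_trans tt' h).
  by case: ifP => // _; exact: mean3_ge0.
rewrite ler_pM2r ?invr_gt0 //; apply: ler_sum => a _; apply: IH; last lra.
exact: subcell_ge0.
Qed.

(** All three children of a selected subcell are selected, so these inner sums increase with the
    level. *)
Lemma capsum_leS k n t x : (forall j, 0 <= x j) ->
  capsum k n t x <= capsum k n.+1 t x.
Proof.
elim: n t x => [|n IH] t x x0.
  have [t0|t0] := leP t 0; first by rewrite !capsum_full.
  by rewrite [X in X <= _]/= (lt_geF t0) capsum_ge0.
rewrite /= ler_pM2r ?invr_gt0 //; apply: ler_sum => a _; apply: IH.
exact: subcell_ge0.
Qed.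

Lemma sum_if_eq k (c : R) : \sum_a (if a == k then c else 0) = c.
Proof. by rewrite big_I3; elim/I3_case: k => /=; ring. Qed.

Lemma sum_if_neq k (c : R) : \sum_a (if a == k then 0 else c) = 2 * c.
Proof. by rewrite big_I3; elim/I3_case: k => /=; ring. Qed.

Lemma capsum_le_mean3 k n t x : (forall j, 0 <= x j) -> capsum k n t x <= mean3 x.
Proof.
move=> x0; have [t0|t0] := leP t 0; first by rewrite capsum_full.
by rewrite -(@capsum_full k n 0) // capsum_nincr // ltW.
Qed.

(** The threshold [t - 2 ^- n] selects the level-[n] subcells whose largest [k]-th coordinate
    reaches [t]. A selected child has a selected parent, so these outer sums decrease with the
    level. *)
Lemma capsum_shift_le k n t x : (forall j, 0 <= x j) ->
  capsum k n.+1 (t - 2 ^- n.+1) x <= capsum k n (t - 2 ^- n) x.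
Proof.
elim: n t x => [|n IH] t x x0.
  have [t1|t1] := leP t 1.
    rewrite [X in _ <= X]capsum_full; last by rewrite expr0 invr1; lra.
    exact: capsum_le_mean3.
  by rewrite capsum_empty ?subrK // capsum_ge0.
rewrite [X in X <= _]/= [X in _ <= X]/= ler_pM2r ?invr_gt0 //.
apply: ler_sum => a _.
have e m (c : R) : 2 * (t - 2 ^- m.+1) - c = (2 * t - c) - 2 ^- m.
  by rewrite -(halfX m); ring.
rewrite !e; apply: IH; exact: subcell_ge0.
Qed.

(* Of the three subcells, only one kind (the two with [a != k], or the one with
   [a = k]) meets a strip of width [2 ^- n.+1]. *)
Lemma capsum_strip k n t x : (forall j, 0 <= x j) -> (forall j, x j <= 1) ->
  capsum k n (t - 2 ^- n) x - capsum k n t x <= (2 / 3) ^+ n.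
Proof.
elim: n t x => [|n IH] t x x0 x1.
  have := mean3_le1 x1; have := mean3_ge0 x0; rewrite /= expr0.
  by case: ifP => _; case: ifP => _; lra.
rewrite /= -mulrBl -sumrB.
have e (c : R) : 2 * (t - 2 ^- n.+1) - c = (2 * t - c) - 2 ^- n.
  by rewrite -(halfX n); ring.
under eq_bigr do rewrite e.
have q0 : 0 <= (2 / 3 : R) ^+ n by rewrite exprn_ge0 // divr_ge0.
(* For [t <= 1 / 2] the subcell [a = k] counts fully in both sums and cancels; for [t > 1 / 2] the
   two other subcells count in neither. *)
have [t1|t1] := leP t (1 / 2).
- pose F a : R := if a == k then 0 else (2 / 3) ^+ n.
  have : \sum_a F a = 2 * (2 / 3) ^+ n.
    exact: sum_if_neq.
  rewrite exprS => s; rewrite (_ : 2 / 3 * _ = (\sum_a F a) / 3); last first.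
    by rewrite s; ring.
  rewrite ler_pM2r ?invr_gt0 //; apply: ler_sum => a _; rewrite /F.
  case: (a == k) => /=.
    have p : 0 < (2 ^- n : R) by rewrite invr_gt0 exprn_gt0.
    by rewrite !capsum_full ?subrr //; lra.
  by apply: IH; [exact: subcell_ge0|exact: subcell_le1].
- have -> : (2 / 3 : R) ^+ n.+1 = 2 * (2 / 3) ^+ n / 3 by rewrite exprS; ring.
  rewrite ler_pM2r ?invr_gt0 //.
  pose F a : R := if a == k then (2 / 3) ^+ n else 0.
  have s : \sum_a F a = (2 / 3) ^+ n.
    exact: sum_if_eq.
  apply: (@le_trans _ _ (\sum_a F a)); last by rewrite s; lra.
  apply: ler_sum => a _; rewrite /F; case: (a == k) => /=.
    by apply: IH; [exact: subcell_ge0|exact: subcell_le1].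
  have p : 0 < (2 ^- n : R) by rewrite invr_gt0 exprn_gt0.
  by rewrite !capsum_empty ?subrr //; lra.
Qed.

Definition unit1 : 'I_3 -> R := fun j => (j == i1)%:R.

(** A cap sum is linear in [x] and symmetric in the two vertices other than [k], so it only involves
    [x k] and the total, with coefficients independent of [k]. They are read off at the constant 1
    and at [unit1], for [k = i0]. *)
Lemma capsum_linear k n t x :
  capsum k n t x =
  capsum i0 n t (fun=> 1) * x k
  + capsum i0 n t unit1 * (\sum_j x j - 3 * x k).
Proof.
have [e [b H]] : exists e b, forall k x, capsum k n t x =
    e * x k + b * (\sum_j x j - 3 * x k).
  elim: n t {k x} => [|n IH] t.
    have [t0|t0] := leP t 0; last first.
      by exists 0, 0 => k x; rewrite /= leNgt t0 /=; ring.
    by exists 1, (1 / 3) => k x; rewrite /= t0 /mean3; field.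
  have [e0 [b0 H0]] := IH (2 * t); have [e1 [b1 H1]] := IH (2 * t - 1).
  (* [al] and [be] are the coefficients of [x k] and of the total [\sum_j x j], collected over the
     three subcells by the 1/5-2/5 rule. *)
  pose al := 3^-1 * ((e1 - 3 * b1) + 6 / 5 * b1 + (e0 - 3 * b0) / 5 - 6 / 5 * b0).
  pose be := 3^-1 * (3 / 5 * b1 + 3 / 5 * (e0 - 3 * b0) + 12 / 5 * b0).
  exists (al + 3 * be), be => k x.
  rewrite /= (eq_bigr (fun a => if a == k
     then e1 * subcell x a k + b1 * (\sum_j subcell x a j - 3 * subcell x a k)
     else e0 * subcell x a k + b0 * (\sum_j subcell x a j - 3 * subcell x a k)));
    last first.
    by move=> a _; case: eqP => /= _; rewrite ?subr0 ?H0 ?H1.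
  under eq_bigr do rewrite subcell_sum.
  rewrite /al /be /subcell !big_I3.
  by elim/I3_case: k => /=; field.
by rewrite !H /unit1 !big_I3 /=; ring.
Qed.

End Extension.

(** * Limits of cap sums and the equations for the parameters *)

Section CapLimit.
Variable R : realType.
Variable x : 'I_3 -> R.
Hypothesis x0 : forall j, 0 <= x j.
Hypothesis x1 : forall j, x j <= 1.
Implicit Types (t : R) (n : nat).

(** Fixing the corner [i0] loses nothing, since [capsum_linear] expresses the cap sums at any corner
    through those at [i0]. *)
Definition cap t : R := limn (fun n => capsum i0 n t x).

Lemma capsum_ndecr t : nondecreasing_seq (fun n => capsum i0 n t x).
Proof. by apply/nondecreasing_seqP => n; exact: capsum_leS. Qed.

Lemma capsum_cvg t : (fun n => capsum i0 n t x) @ \oo --> cap t.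
Proof.
have : cvgn (fun n => capsum i0 n t x).
  apply: nondecreasing_is_cvgn; first exact: capsum_ndecr.
  by exists (mean3 x) => _ [n _ <-]; exact: capsum_le_mean3.
by [].
Qed.

Lemma capsum_le_cap n t : capsum i0 n t x <= cap t.
Proof.
apply: nondecreasing_cvgn_le; first exact: capsum_ndecr.
by apply/cvg_ex; exists (cap t); exact: capsum_cvg.
Qed.

(** Inner sums lie below the outer sums of the same level, and the outer sums decrease, so each
    outer sum bounds the limit. *)
Lemma cap_le_capsum n t : cap t <= capsum i0 n (t - 2 ^- n) x.
Proof.
apply: limr_le; first by apply/cvg_ex; exists (cap t); exact: capsum_cvg.
exists n => // N /= nN.
apply: (@le_trans _ _ (capsum i0 N (t - 2 ^- N) x)).
  by apply: capsum_nincr => //; rewrite gerBl invr_ge0 exprn_ge0.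
elim: N nN => [|N IH]; first by rewrite leqn0 => /eqP ->.
rewrite leq_eqVlt => /predU1P[-> //|/IH]; apply: le_trans.
exact: capsum_shift_le.
Qed.

Lemma cap_nincr t t' : t <= t' -> cap t' <= cap t.
Proof.
move=> tt'; apply: limr_le; first by apply/cvg_ex; exists (cap t'); exact: capsum_cvg.
near=> n; apply: le_trans (capsum_le_cap n t); exact: capsum_nincr.
Unshelve. all: by end_near. Qed.

Lemma cap_full t : t <= 0 -> cap t = mean3 x.
Proof.
move=> t0; rewrite /cap; under eq_fun do rewrite capsum_full //.
exact: lim_cst.
Qed.

Lemma cap_empty t : 1 <= t -> cap t = 0.
Proof.
move=> t1; rewrite /cap.
under eq_fun => n do rewrite capsum_empty ?(le_lt_trans t1) ?ltrDl ?invr_gt0 ?exprn_gt0 //.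
exact: lim_cst.
Qed.

(** Bounding the left side by an outer sum and [cap t] from below by an inner sum leaves two
    adjacent strips of width [2 ^- n], each worth at most [(2 / 3) ^+ n]. *)
Lemma cap_modulus n t : cap (t - 2 ^- n) <= cap t + 2 * (2 / 3) ^+ n.
Proof.
have := cap_le_capsum n (t - 2 ^- n).
have := capsum_strip i0 n (t - 2 ^- n) x0 x1.
have := capsum_strip i0 n t x0 x1.
have := capsum_le_cap n t.
lra.
Qed.

Lemma cap_continuous : continuous cap.
Proof.
move=> t; apply/cvgrPdist_le => /= e e0.
have [n hn] : exists n, 2 * (2 / 3 : R) ^+ n <= e.
  have : (fun n => 2 * (2 / 3 : R) ^+ n) @ \oo --> 2 * (0 : R).
    by apply: cvgMl_tmp; apply: cvg_expr; rewrite ger0_norm; lra.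
  rewrite mulr0 => /cvgrPdist_le /(_ e e0) [n _ /(_ n (leqnn n))] /= h.
  exists n; move: h; rewrite sub0r normrN ger0_norm //.
have p : 0 < (2 ^- n : R) by rewrite invr_gt0 exprn_gt0.
near=> s.
have : `|t - s| < 2 ^- n.
  by near: s; exact: cvgr_dist_lt.
rewrite ltr_norml => /andP[h1 h2]; rewrite ler_norml.
have := cap_modulus n t; have := cap_modulus n s.
have [ts|st] := leP t s.
- have := cap_nincr ts.
  have : cap t <= cap (s - 2 ^- n) by apply: cap_nincr; lra.
  by move=> *; apply/andP; split; lra.
- have := cap_nincr (ltW st).
  have : cap s <= cap (t - 2 ^- n) by apply: cap_nincr; lra.
  by move=> *; apply/andP; split; lra.
Unshelve. all: by end_near. Qed.

End CapLimit.

(** * Solving the equations for the three cap parameters *)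

Section Solve.
Variables (R : realType) (e b : R -> R).
Hypotheses (ce : continuous e) (cb : continuous b).
Hypotheses (he : {homo e : x y / x <= y}) (hb : {homo b : x y / x <= y}).
Hypotheses (e_0 : e 0 = 0) (e_1 : e 1 = 1) (b_0 : b 0 = 0) (b_1 : b 1 = 1 / 3).

(** Compares the coefficients of the three vertex values in the normalised integral with the target
    weights times the mass [T]. The central cell gives [1 / 3] to each vertex; a cap of parameter
    [c] gives [e c + 2 * b c] to its own vertex and [- b c] to the two others. *)
Definition balanced (p q r x y z : R) : Prop :=
  let T := 1 + e x + e y + e z in
  [/\ 1 / 3 + e x + 2 * b x - b y - b z = p * T,
      1 / 3 + e y + 2 * b y - b x - b z = q * T &
      1 / 3 + e z + 2 * b z - b x - b y = r * T].

Lemma IVT01 (f : R -> R) (u v : R) : u <= 1 -> continuous f ->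
  f u <= v -> v <= f 1 -> exists2 x, x \in `[u, 1]%R & f x = v.
Proof.
move=> u1 cf h0 h1; apply: IVT => //.
- exact: continuous_subspaceT.
- by rewrite ge_min h0 le_max h1 orbT.
Qed.

Lemma balanced_sorted (p q r : R) : r <= q -> q <= p -> 0 <= r -> p + q + r = 1 ->
  exists x y, [/\ 0 <= x <= 1, 0 <= y <= 1 & balanced p q r x y 0].
Proof.
move=> rq qp r0 s.
have e01 x : 0 <= x <= 1 -> 0 <= e x <= 1.
  by move=> /andP[h1 h2]; rewrite -e_0 -e_1 !he.
have b01 x : 0 <= x <= 1 -> 0 <= b x <= 1 / 3.
  by move=> /andP[h1 h2]; rewrite -b_0 -b_1 !hb.
(* With [z = 0] the second equation reads [B y = q - 1 / 3 + b x + q * e x]. The right side may be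
   negative for small [x]; [rho] truncates it at 0. *)
pose B y := (1 - q) * e y + 2 * b y.
pose rho x := Num.max 0 (q - 1 / 3 + b x + q * e x).
have cB : continuous B.
  by move=> y; apply: cvgD; apply: cvgMl_tmp; [exact: ce|exact: cb].
have crho : continuous rho.
  move=> x.
  apply: (@continuous_max R R (fun=> 0) (fun x => q - 1 / 3 + b x + q * e x));
    first exact: cvg_cst.
  apply: cvgD; last by apply: cvgMl_tmp; exact: ce.
  by apply: cvgD; [exact: cvg_cst|exact: cb].
have rho_B1 x : x \in `[0, 1]%R -> rho x <= B 1.
  rewrite in_itv /= => x01; have := e01 _ x01; have := b01 _ x01.
  move=> /andP[? ?] /andP[? ?].
  have : q * e x <= q by rewrite ler_piMr //; lra.
  by rewrite /rho /B e_1 b_1 ge_max; move=> ?; apply/andP; split; lra.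
(* The truncation at [B 1] makes the equation solvable for every real [x], so that [Y] is total and
   [B \o Y] is continuous everywhere; on [[0, 1]] it has no effect by [rho_B1]. *)
have Yex x : exists y, y \in `[0, 1]%R /\ B y = Num.min (B 1) (rho x).
  have [||||y yi yE] := @IVT01 B 0 (Num.min (B 1) (rho x)).
  - lra.
  - exact: cB.
  - rewrite {1}/B e_0 b_0 !mulr0 addr0 le_min le_max lexx /= andbT.
    by rewrite /B e_1 b_1; lra.
  - by rewrite ge_min lexx.
  by exists y.
have [Y HY] := choice Yex.
have BY x : x \in `[0, 1]%R -> B (Y x) = rho x.
  by move=> xi; rewrite (HY x).2; apply/min_idPr; exact: rho_B1.
(* [e] and [b] are Lipschitz functions of [B], so flat pieces of [B] are harmless. *)
have lip y y' : `|e y - e y'| <= 2 * `|B y - B y'| /\ `|b y - b y'| <= 2 * `|B y - B y'|.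
  wlog yy' : y y' / y <= y'.
    move=> H; have [/H //|/ltW /H] := leP y y'.
    by rewrite (distrC (e y')) (distrC (b y')) (distrC (B y')).
  have h1 := he yy'; have h2 := hb yy'.
  (* From [q <= p] and [p + q + r = 1] one gets [q <= 1 / 2], hence [1 - q >= 1 / 2] and the
     Lipschitz constant 2. *)
  have h3 : (1 / 2) * (e y' - e y) <= (1 - q) * (e y' - e y).
    by rewrite ler_wpM2r //; lra.
  have BE : B y' - B y = (1 - q) * (e y' - e y) + 2 * (b y' - b y).
    by rewrite /B; ring.
  rewrite (distrC (e y)) (distrC (b y)) (distrC (B y)) !ger0_norm ?subr_ge0 //; first by split; lra.
  by rewrite -subr_ge0 BE addr_ge0 // mulr_ge0 // ?subr_ge0 //; lra.
have cY (f : R -> R) : (forall y y', `|f y - f y'| <= 2 * `|B y - B y'|) -> continuous (f \o Y).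
  move=> lf x; apply/cvgrPdist_le => /= d d0.
  have cBY : continuous (fun x => B (Y x)).
    rewrite (_ : (fun x => _) = (fun x => Num.min (B 1) (rho x))).
      by move=> z; apply: (@continuous_min R R (fun=> B 1) rho); [exact: cvg_cst|exact: crho].
    by apply/funext => z; rewrite (HY z).2.
  near=> z; apply: (le_trans (lf _ _)).
  have : `|B (Y x) - B (Y z)| <= d / 2.
    by near: z; apply: (@cvgr_dist_le _ _ _ _ _ (fun z => B (Y z))); [exact: cBY|lra].
  lra.
(* A zero of [G] solves the third equation with [z = 0] and [y = Y x]. *)
pose G x := 1 / 3 - b x - b (Y x) - r * (1 + e x + e (Y x)).
have cG : continuous G.
  have ceY := cY e (fun y y' => (lip y y').1).
  have cbY := cY b (fun y y' => (lip y y').2).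
  move=> x; apply: cvgB; last first.
    apply: cvgMl_tmp; apply: cvgD; last exact: ceY.
    by apply: cvgD; [exact: cvg_cst|exact: ce].
  apply: cvgB; last exact: cbY.
  by apply: cvgB; [exact: cvg_cst|exact: cb].
(* Nonnegativity of the untruncated right side at [u] persists on [[u, 1]] by monotonicity, so there
   [Y] solves the true second equation. *)
have [u [u0 u1 ru Gu]] : exists u, [/\ 0 <= u, u <= 1,
    0 <= q - 1 / 3 + b u + q * e u & 0 <= G u].
  have Y01 x := (HY x).1.
  have [q3|q3] := leP q (1 / 3).
  - have [||||u ui uE] := @IVT01 (fun x => b x + q * e x) 0 (1 / 3 - q).
    + lra.
    + move=> y; apply: cvgD; [exact: cb|by apply: cvgMl_tmp; exact: ce].
    + by rewrite e_0 b_0 mulr0 addr0; lra.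
    + by rewrite e_1 b_1; lra.
    have ui' := ui; rewrite in_itv /= in ui; have /andP[] := ui => u0 u1.
    (* Here the second cap has [e = b = 0], so the coefficients of the last two vertices agree;
       their common value is [q * T], which is at least [r * T]. *)
    have BY0 : B (Y u) = 0 by rewrite BY // /rho; apply/max_idPl; lra.
    exists u; split => //; first lra.
    have := lip (Y u) 0; rewrite BY0 e_0 b_0 {1 2}/B e_0 b_0 !mulr0 addr0 subrr normr0 mulr0 !subr0.
    rewrite !normr_le0 => -[/eqP eY /eqP bY].
    rewrite /G eY bY.
    have : r * (1 + e u) <= q * (1 + e u).
      by have/andP[eu _] : 0 <= e u <= 1 := e01 u ui; rewrite ler_wpM2r //; lra.
    lra.
  (* Without a cap at the first vertex, the first and third coefficients agree, each being
     [(1 - q) / 2 * T], and [r <= (1 - q) / 2] because [r <= p]. *)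
  - exists 0; rewrite lexx ler01 e_0 b_0 mulr0 !addr0; split => //; first lra.
    have : B (Y 0) = q - 1 / 3.
      rewrite BY ?in_itv /= ?lexx ?ler01 // /rho e_0 b_0 mulr0 !addr0.
      by apply/max_idPr; lra.
    rewrite /B /G e_0 b_0 => H.
    have : r * (1 + e (Y 0)) <= (1 - q) / 2 * (1 + e (Y 0)).
      rewrite ler_wpM2r //; last lra.
      by have/andP[] := e01 (Y 0) (Y01 0); lra.
    lra.
have G1 : G 1 <= 0.
  have /andP[y0 y1] := b01 (Y 1) (HY 1).1.
  have /andP[y2 y3] := e01 (Y 1) (HY 1).1.
  rewrite /G e_1 b_1; have : 0 <= r * (1 + 1 + e (Y 1)) by rewrite mulr_ge0 //; lra.
  lra.
have [|||x xi Gx] := @IVT01 (fun x => - G x) u 0 u1.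
- by move=> y; apply: cvgN; exact: cG.
- lra.
- lra.
move: xi; rewrite in_itv /= => /andP[ux x1].
have x01 : 0 <= x <= 1 by rewrite (le_trans u0 ux).
exists x, (Y x); split => //; first exact: (HY x).1.
have BYx : B (Y x) = q - 1 / 3 + b x + q * e x.
  rewrite BY // /rho; apply/max_idPr; apply: (le_trans ru).
  rewrite lerD ?ler_wpM2l ?he //; last lra.
  by rewrite lerD ?hb.
rewrite /B in BYx; rewrite /G in Gx.
(* The three left sides of [balanced] add up to [T], so the first equation follows from the other
   two. *)
have pE : p = 1 - q - r by lra.
have GE : r * (1 + e x + e (Y x)) = 1 / 3 - b x - b (Y x) by lra.
rewrite /balanced e_0 b_0 !addr0 !subr0 mulr0 addr0 pE; split; last lra.
- rewrite !mulrBl GE; lra.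
- lra.
Unshelve. all: by end_near. Qed.

(** The system is invariant under permuting the weights together with the parameters, which reduces
    it to sorted weights. *)
Lemma balanced_exists (p q r : R) : 0 <= p -> 0 <= q -> 0 <= r -> p + q + r = 1 ->
  exists x y z, [/\ 0 <= x <= 1, 0 <= y <= 1, 0 <= z <= 1 & balanced p q r x y z].
Proof.
have z01 : 0 <= (0 : R) <= 1 by rewrite lexx ler01.
move=> p0 q0 r0 s.
pose ex u v w := exists x y z,
  [/\ 0 <= x <= 1, 0 <= y <= 1, 0 <= z <= 1 & balanced u v w x y z].
have s12 u v w : ex u v w -> ex v u w.
  move=> [x [y [z [hx hy hz [h1 h2 h3]]]]]; exists y, x, z.
  by split => //; split; lra.
have s23 u v w : ex u v w -> ex u w v.
  move=> [x [y [z [hx hy hz [h1 h2 h3]]]]]; exists x, z, y.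
  by split => //; split; lra.
have sorted u v w : 0 <= w -> u + v + w = 1 -> w <= v -> v <= u -> ex u v w.
  move=> w0 suvw wv vu; have [x [y [x01 y01 B]]] := balanced_sorted wv vu w0 suvw.
  by exists x, y, 0.
have [pq|/ltW qp] := leP p q; have [qr|/ltW rq] := leP q r.
- by apply/s12/s23/s12/sorted => //; lra.
- have [pr|/ltW rp] := leP p r; first by apply/s12/s23/sorted => //; lra.
  by apply/s12/sorted => //; lra.
- have [pr|/ltW rp] := leP p r; last by apply/s23/sorted => //; lra.
  by apply/s23/s12/sorted => //; lra.
- by apply/sorted => //; lra.
Qed.

End Solve.

(** * Barycentric coordinates and cells *)

Section Barycentric.
Variables (R : realType) (q : 'I_3 -> R * R).
Hypothesis eq_q : equilateral q.
Implicit Types (y z : R * R) (k a b : 'I_3) (u v : seq 'I_3).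

Definition sqside : R := dotp (subp (q i0) (q i1)) (subp (q i0) (q i1)).

Lemma sqside_gt0 : 0 < sqside.
Proof. by case: eq_q => _ []. Qed.

(** The vectors from the centroid to the vertices have squared length [sqside / 3] and mutual
    products [- sqside / 6], so this affine function is 1 at [q k] and 0 at the two other
    vertices. *)
Definition bary k y : R :=
  1 / 3 + 2 / sqside * dotp (subp y (centroid q)) (subp (q k) (centroid q)).

Lemma sqside_eq a b : a != b -> dotp (subp (q a) (q b)) (subp (q a) (q b)) = sqside.
Proof.
case: eq_q => /= e1 [e2 _].
have sy c d : dotp (subp (q c) (q d)) (subp (q c) (q d)) =
              dotp (subp (q d) (q c)) (subp (q d) (q c)).
  by rewrite /dotp /subp /=; ring.
by elim/I3_case: a; elim/I3_case: b => // _;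
  rewrite /sqside ?(sy i1 i0) ?(sy i2 i0) ?(sy i2 i1) ?e1 ?e2.
Qed.

Lemma bary_vertex k a : bary k (q a) = (a == k)%:R.
Proof.
have d0 : sqside != 0 by rewrite gt_eqF ?sqside_gt0.
have e01 := @sqside_eq i0 i1 isT; have e12 := @sqside_eq i1 i2 isT.
have e02 := @sqside_eq i0 i2 isT.
rewrite /bary; suff -> : dotp (subp (q a) (centroid q)) (subp (q k) (centroid q)) =
    sqside * ((a == k)%:R - 1 / 3) / 2 by field.
move: e01 e12 e02; rewrite /dotp /subp /centroid.
elim/I3_case: a; elim/I3_case: k => /=; lra.
Qed.

Lemma bary_Fmap k a y : bary k (Fmap q a y) = (bary k y + (a == k)%:R) / 2.
Proof.
by rewrite -bary_vertex /bary /Fmap /midp /dotp /subp /=; field; rewrite gt_eqF ?sqside_gt0.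
Qed.

Lemma bary_sum y : \sum_k bary k y = 1.
Proof.
rewrite big_I3 /bary /dotp /subp /centroid /=.
by field; rewrite gt_eqF ?sqside_gt0.
Qed.

(** The difference of the points is orthogonal to two sides of the triangle; the squared determinant
    of these sides is [3 / 4 * d ^+ 2], nonzero by the Lagrange identity, and Cramer's rule
    concludes. *)
Lemma bary_inj y z : (forall k, bary k y = bary k z) -> y = z.
Proof.
have d0 := sqside_gt0.
move=> h; have c : 2 / sqside != 0 by rewrite gt_eqF // divr_gt0.
have dk k : dotp (subp y z) (subp (q k) (centroid q)) = 0.
  have /addrI/(mulfI c) := h k; rewrite /dotp /subp /=; lra.
have := @sqside_eq i0 i1 isT; have := @sqside_eq i1 i2 isT.
have := @sqside_eq i0 i2 isT.
have := dk i0; have := dk i1; have := dk i2.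
case: y z {h dk} => y1 y2 [z1 z2]; rewrite /dotp /subp /centroid /=.
move: (q i0) (q i1) (q i2) (sqside) d0 => [a1 a2] [b1 b2] [c1 c2] d d0 /=.
move=> h2 h1 h0 e02 e12 e01.
pose u1 := b1 - a1; pose u2 := b2 - a2; pose v1 := c1 - a1; pose v2 := c2 - a2.
have hu : (y1 - z1) * u1 + (y2 - z2) * u2 = 0 by rewrite /u1 /u2; lra.
have hv : (y1 - z1) * v1 + (y2 - z2) * v2 = 0 by rewrite /v1 /v2; lra.
have D : (u1 * v2 - u2 * v1) ^+ 2 = 3 / 4 * d ^+ 2.
  have eu : u1 * u1 + u2 * u2 = d by rewrite /u1 /u2; lra.
  have ev : v1 * v1 + v2 * v2 = d by rewrite /v1 /v2; lra.
  have euv : u1 * v1 + u2 * v2 = d / 2 by rewrite /u1 /u2 /v1 /v2; lra.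
  have -> : (u1 * v2 - u2 * v1) ^+ 2 =
    (u1 * u1 + u2 * u2) * (v1 * v1 + v2 * v2) - (u1 * v1 + u2 * v2) ^+ 2 by ring.
  by rewrite eu ev euv; field.
have D0 : u1 * v2 - u2 * v1 != 0.
  by rewrite -sqrf_eq0 D gt_eqF // mulr_gt0 // exprn_gt0.
have r1 : (y1 - z1) * (u1 * v2 - u2 * v1) = 0.
  transitivity (((y1 - z1) * u1 + (y2 - z2) * u2) * v2 -
    ((y1 - z1) * v1 + (y2 - z2) * v2) * u2); first by ring.
  by rewrite hu hv; ring.
have r2 : (y2 - z2) * (u1 * v2 - u2 * v1) = 0.
  transitivity (((y1 - z1) * v1 + (y2 - z2) * v2) * u1 -
    ((y1 - z1) * u1 + (y2 - z2) * u2) * v1); first by ring.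
  by rewrite hu hv; ring.
move/eqP: r1; rewrite mulf_eq0 (negbTE D0) orbF subr_eq0 => /eqP ->.
by move/eqP: r2; rewrite mulf_eq0 (negbTE D0) orbF subr_eq0 => /eqP ->.
Qed.

Lemma Fword_cat u v y : Fword q (u ++ v) y = Fword q u (Fword q v y).
Proof. by elim: u => //= a u ->. Qed.

Lemma bary_Fword k v y : bary k (Fword q v y) = 2 ^- size v * bary k y + low R k v.
Proof.
elim: v => [|a v IH] /=; first by rewrite expr0 invr1 mul1r addr0.
by rewrite bary_Fmap IH -(halfX R); field.
Qed.

Lemma Fmap_inj a : injective (Fmap q a).
Proof.
move=> y z e; apply: bary_inj => k; have := bary_Fmap k a y.
by rewrite e bary_Fmap; lra.
Qed.

Lemma Fmap_vertex a : Fmap q a (q a) = q a.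
Proof. by rewrite /Fmap /midp; case: (q a) => s t /=; congr pair; field. Qed.

Lemma Fmap_vertexC a b : Fmap q a (q b) = Fmap q b (q a).
Proof. by rewrite /Fmap /midp; congr pair; ring. Qed.

End Barycentric.

(** * Points of the gasket and intersections of cells of equal level *)

Section Gasket.
Variables (R : realType) (q : 'I_3 -> R * R) (K : set (R * R)).
Hypothesis eq_q : equilateral q.
Hypothesis sgK : is_SG q K.
Implicit Types (y z : R * R) (k a b : 'I_3) (u v w : seq 'I_3).

Lemma bary_continuous k : continuous (bary q k).
Proof.
have c1 : continuous (@fst R R) by move=> z; exact: cvg_fst.
have c2 : continuous (@snd R R) by move=> z; exact: cvg_snd.
move=> z; apply: cvgD; first exact: cvg_cst.
apply: cvgM; first exact: cvg_cst.
apply: cvgD.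
- apply: cvgM; last exact: cvg_cst.
  by apply: cvgB; [exact: c1|exact: cvg_cst].
- apply: cvgM; last exact: cvg_cst.
  by apply: cvgB; [exact: c2|exact: cvg_cst].
Qed.

Lemma Fmap_K a y : K y -> K (Fmap q a y).
Proof. by move=> Ky; case: sgK => _ [_ ->]; exists a => //; exists y. Qed.

Lemma K_Fmap y : K y -> exists a, exists2 z, K z & y = Fmap q a z.
Proof.
case: sgK => _ [_ E]; rewrite {1}E => -[a _ [z Kz <-]].
by exists a, z.
Qed.

Lemma Fword_K u y : K y -> K (Fword q u y).
Proof. by move=> Ky; elim: u => //= a u; exact: Fmap_K. Qed.

Lemma K_Fword n y : K y -> exists2 u, size u = n & exists2 z, K z & y = Fword q u z.
Proof.
elim: n y => [|n IH] y Ky; first by exists [::] => //; exists y.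
have [a [z /IH[u un [z' Kz' ->]] ->]] := K_Fmap Ky.
by exists (a :: u); rewrite /= ?un //; exists z'.
Qed.

(** A minimum point is some [Fmap q a z], so the minimum is at least half the coordinate of [z],
    hence at least half of itself. *)
Lemma bary_ge0 k y : K y -> 0 <= bary q k y.
Proof.
case: sgK => cK [K0 _].
have [c cK' cmin] := compact_EVT_min K0 cK (continuous_subspaceT (@bary_continuous k)).
move: (cK'); rewrite inE => /K_Fmap[a [z Kz cE]].
have := cmin z; rewrite inE => /(_ Kz); rewrite cE bary_Fmap // => h Ky.
have := cmin y; rewrite inE => /(_ Ky); rewrite cE bary_Fmap //.
by move: h; case: (a == k) => /=; lra.
Qed.

Lemma bary_le1 k y : K y -> bary q k y <= 1.
Proof.
move=> Ky; have := bary_sum eq_q y; rewrite big_I3.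
have := bary_ge0 i0 Ky; have := bary_ge0 i1 Ky; have := bary_ge0 i2 Ky.
by elim/I3_case: k; lra.
Qed.

Lemma bary_eq1 a y : K y -> bary q a y = 1 -> y = q a.
Proof.
move=> Ky y1; apply: (bary_inj eq_q) => k; rewrite bary_vertex //.
have := bary_sum eq_q y; rewrite big_I3.
have := bary_ge0 i0 Ky; have := bary_ge0 i1 Ky; have := bary_ge0 i2 Ky.
by move: y1; elim/I3_case: a; elim/I3_case: k => /=; lra.
Qed.

(** Applying [Fmap q a] at a maximum point of the [a]-th coordinate halves its distance to 1, so the
    maximum is 1, and only [q a] attains it. *)
Lemma vertex_K a : K (q a).
Proof.
case: sgK => cK [K0 _].
have [c] := compact_EVT_max K0 cK (continuous_subspaceT (@bary_continuous a)).
rewrite inE => Kc cmax.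
have := cmax (Fmap q a c); rewrite inE => /(_ (Fmap_K a Kc)).
rewrite bary_Fmap // eqxx /= => h.
have := bary_le1 a Kc => h'.
by rewrite -(@bary_eq1 a c) //; lra.
Qed.

Lemma Fword_corner a u z : K z -> Fword q u z = q a ->
  u = nseq (size u) a /\ z = q a.
Proof.
move=> Kz; elim: u => //= b u IH e.
have Ku := Fword_K u Kz.
have := congr1 (bary q a) e; rewrite bary_Fmap // bary_vertex // eqxx {e} => h.
have h' := bary_le1 a Ku.
have [ab|ab] := eqVneq b a; last by exfalso; move: h; rewrite (negbTE ab) /=; lra.
move: h; rewrite ab eqxx /= => h.
have u1 : bary q a (Fword q u z) = 1 by lra.
by have [{1}-> ->] := IH (bary_eq1 Ku u1).
Qed.

(** The [a]-th coordinate is at least [1 / 2] on the cell of [a] and at most [1 / 2] on that of [b],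
    so a common point has extreme preimages. *)
Lemma Fmap_meet a b y z : a != b -> K y -> K z -> Fmap q a y = Fmap q b z ->
  y = q b /\ z = q a.
Proof.
have half c d (s t : R * R) : c != d -> K s -> K t -> Fmap q c s = Fmap q d t -> t = q c.
  move=> cd Ks Kt e; apply: bary_eq1 => //; apply/eqP; rewrite eq_le bary_le1 //=.
  have := congr1 (bary q c) e; rewrite !bary_Fmap // eqxx eq_sym (negbTE cd) /= {e}.
  have := bary_ge0 c Ks; lra.
by move=> ab Ky Kz e; split; [apply: (half b a z y); rewrite // eq_sym|apply: (half a b y z)].
Qed.

Lemma cells_meet_uniq u v y y' z z' : size u = size v -> u <> v ->
  K y -> K y' -> K z -> K z' ->
  Fword q u y = Fword q v y' -> Fword q u z = Fword q v z' -> y = z.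
Proof.
move=> + + Ky Ky' Kz Kz'.
elim: u v => [|a u IH] [|b v] //= [suv] uv.
have [ab|ab] := eqVneq a b.
  move: uv; rewrite ab => uv /(Fmap_inj eq_q) e1 /(Fmap_inj eq_q) e2.
  by apply: (IH v) => // e; apply: uv; rewrite e.
move=> /(Fmap_meet ab (Fword_K u Ky) (Fword_K v Ky'))[e1 _].
move=> /(Fmap_meet ab (Fword_K u Kz) (Fword_K v Kz'))[e2 _].
by have [_ ->] := Fword_corner Ky e1; have [_ ->] := Fword_corner Kz e2.
Qed.

Lemma cells_meet_vertex u v y z : size u = size v -> u <> v ->
  K y -> K z -> Fword q u y = Fword q v z -> exists k, z = q k.
Proof.
move=> + + Ky Kz.
elim: u v => [|a u IH] [|b v] //= [suv] uv.
have [ab|ab] := eqVneq a b.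
  move: uv; rewrite ab => uv /(Fmap_inj eq_q) e1.
  by apply: (IH v) => // e; apply: uv; rewrite e.
move=> /(Fmap_meet ab (Fword_K u Ky) (Fword_K v Kz))[_ e].
by exists a; have [_ ->] := Fword_corner Kz e.
Qed.

(** Three distinct first letters would force one preimage to be two different vertices; if two first
    letters agree, [Fword_corner] determines both tails, and if all agree one descends. *)
Lemma cells_meet_two u v w x y z : size u = size v -> size u = size w ->
  K x -> K y -> K z -> u <> v -> Fword q u x = Fword q v y ->
  Fword q u x = Fword q w z -> w = u \/ w = v.
Proof.
move=> + + Kx Ky Kz.
elim: u v w => [|a u IH] [|b v] [|c w] //= [suv] [suw] uv.
have [ab|ab] := eqVneq a b.
  subst b => /(Fmap_inj eq_q) e1.
  have [ac|ac] := eqVneq a c.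
    subst c => /(Fmap_inj eq_q) e2.
    have nuv : u <> v by move=> E; apply: uv; rewrite E.
    by have [->|->] := IH v w suv suw nuv e1 e2; [left|right].
  move=> /(Fmap_meet ac (Fword_K u Kx) (Fword_K w Kz))[e2 _].
  have [eu _] := Fword_corner Kx e2.
  have [ev _] : v = nseq (size v) c /\ y = q c by apply: Fword_corner => //; rewrite -e1.
  by exfalso; apply: uv; rewrite eu ev suv.
move=> e1 e2.
have [h1 h2] := Fmap_meet ab (Fword_K u Kx) (Fword_K v Ky) e1.
have [ac|ac] := eqVneq a c.
  left; subst c; move/(Fmap_inj eq_q): e2 => e2.
  have [-> _] := Fword_corner Kx h1.
  have [-> _] : w = nseq (size w) b /\ z = q b by apply: Fword_corner => //; rewrite -e2.
  by rewrite suw.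
have [bc|bc] := eqVneq b c.
  right; subst c; rewrite e1 in e2; move/(Fmap_inj eq_q): e2 => e2.
  have [-> _] := Fword_corner Ky h2.
  have [-> _] : w = nseq (size w) a /\ z = q a by apply: Fword_corner => //; rewrite -e2.
  by rewrite -suw suv.
have [h3 _] := Fmap_meet ac (Fword_K u Kx) (Fword_K w Kz) e2.
have := congr1 (bary q b) h3; rewrite h1 !bary_vertex // eqxx eq_sym (negbTE bc).
by move/eqP; rewrite oner_eq0.
Qed.

Lemma vertex_inj : injective q.
Proof.
move=> a b e; have := bary_vertex eq_q a b; rewrite -e bary_vertex // eqxx.
by case: eqP => // _ /eqP; rewrite oner_eq0.
Qed.

(** * Harmonic functions: from the mean value at junctions to the extension rule *)

Section Harmonic.
Variable h : R * R -> R.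
Hypothesis hh : SG_harmonic q K h.

Lemma nbrsP m x y : reflect
  (exists v j k, [/\ size v = m, x = Fword q v (q k), x <> Fword q v (q j) &
    y = Fword q v (q j)]) (y \in nbrs q m x).
Proof.
apply: (iffP idP); rewrite mem_undup.
  move=> /flatten_mapP[t _ /mapP[j]]; rewrite mem_filter.
  move=> /andP[/andP[/existsP[k /eqP xk] /eqP xj] _] ->.
  by exists (val t), j, k; rewrite size_tuple.
move=> [v [j [k [vm xk xj yE]]]].
have vs : size v == m by apply/eqP.
apply/flatten_mapP; exists (Tuple vs); first by rewrite mem_enum.
apply/mapP; exists j => //; rewrite mem_filter mem_enum andbT.
by apply/andP; split; [apply/existsP; exists k; apply/eqP|apply/eqP].
Qed.

Lemma Fword_vertex_inj u : injective (fun j => Fword q u (q j)).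
Proof.
move=> i j; elim: u => /= [/vertex_inj //|a u IH /(Fmap_inj eq_q)]; exact: IH.
Qed.

(** The neighbours of a junction are the two other vertices of each of its two cells; adding
    [2 * h x] to [4 * h x] completes both vertex sums. *)
Lemma harmonic_shared u v k l : size u = size v -> u <> v ->
  Fword q u (q k) = Fword q v (q l) ->
  6 * h (Fword q u (q k)) = \sum_j h (Fword q u (q j)) + \sum_j h (Fword q v (q j)).
Proof.
move=> suv uv e; set x := Fword q u (q k) in e *.
pose nb w c := [seq Fword q w (q j) | j <- enum 'I_3 & j != c].
have memnb w c y : reflect (exists2 j, j != c & y = Fword q w (q j)) (y \in nb w c).
  apply: (iffP mapP) => -[j jc ->]; exists j => //.
    by move: jc; rewrite mem_filter => /andP[].
  by rewrite mem_filter jc mem_enum.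
have P : perm_eq (nbrs q (size u) x) (nb u k ++ nb v l).
  apply: uniq_perm; first exact: undup_uniq.
    have un w c : uniq (nb w c).
      by rewrite (map_inj_uniq (@Fword_vertex_inj w)) filter_uniq // enum_uniq.
    rewrite cat_uniq !un /= andbT; apply/hasPn => y /memnb[j jl ->].
    apply/negP => /memnb[i ik e'].
    have /vertex_inj ki := @cells_meet_uniq u v _ _ _ _ suv uv
      (vertex_K k) (vertex_K l) (vertex_K i) (vertex_K j) e (esym e').
    by rewrite ki eqxx in ik.
  move=> y; rewrite mem_cat; apply/nbrsP/orP.
    move=> [w [j [c [wu xc xj ->]]]].
    have [wE|wE] := @cells_meet_two u v w _ _ _ suv (esym wu)
      (vertex_K k) (vertex_K l) (vertex_K c) uv e xc; subst w.
      by left; apply/memnb; exists j => //; apply/eqP => jk; apply: xj; rewrite jk.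
    by right; apply/memnb; exists j => //; apply/eqP => jl; apply: xj; rewrite jl.
  move=> [/memnb[j jk ->]|/memnb[j jl ->]].
    exists u, j, k; split => // /Fword_vertex_inj kj.
    by rewrite kj eqxx in jk.
  exists v, j, l; split => //; rewrite e => /Fword_vertex_inj kj.
  by rewrite kj eqxx in jl.
have u1 : (1 <= size u)%N.
  by case: u v suv uv {P e memnb nb x} => [|//] [].
(* At each level a boundary vertex lies only in the cell of a constant word, so two distinct cells
   cannot share it. *)
have xV : ~ range q x.
  move=> [a _ ax]; have [eu _] := Fword_corner (vertex_K k) (esym ax).
  rewrite e in ax; have [ev _] := Fword_corner (vertex_K l) (esym ax).
  by apply: uv; rewrite eu ev suv.
have := hh.2 (size u) x u1 _ xV; have xVm : Vm q (size u) x by exists u, k.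
move=> /(_ xVm); rewrite (perm_big _ P) big_cat /= !big_map !big_filter !big_enum_cond /=.
have D1 w c : \sum_j h (Fword q w (q j)) = h (Fword q w (q c)) +
    \sum_(j | j != c) h (Fword q w (q j)) by rewrite (bigD1 c).
rewrite (D1 u k) (D1 v l) -e -/x.
set A := \sum_(_ | _) _; set B := \sum_(_ | _) _.
clear; lra.
Qed.

(** [harmonic_shared] at the three edge midpoints of the cell is a linear system whose unique
    solution is the 1/5-2/5 rule. *)
Lemma harmonic_subcell u a j :
  h (Fword q (u ++ [:: a]) (q j)) = subcell (fun i => h (Fword q u (q i))) a j.
Proof.
rewrite Fword_cat /= /subcell; case: eqP => [->|/eqP ja]; first by rewrite Fmap_vertex.
have eq6 b c : b != c -> 6 * h (Fword q u (Fmap q b (q c))) =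
    \sum_j h (Fword q u (Fmap q b (q j))) + \sum_j h (Fword q u (Fmap q c (q j))).
  move=> bc; have := @harmonic_shared (u ++ [:: b]) (u ++ [:: c]) c b.
  rewrite !size_cat !Fword_cat /= => -> //; last by rewrite Fmap_vertexC.
    under eq_bigr do rewrite Fword_cat /=.
    by under [X in _ + X = _]eq_bigr do rewrite Fword_cat /=.
  by move=> /eqP; rewrite eqseq_cat // eqxx /= eqseq_cons andbT (negbTE bc).
have := eq6 i0 i1 isT; have := eq6 i0 i2 isT; have := eq6 i1 i2 isT.
have s b c := Fmap_vertexC q b c.
rewrite !big_I3 !Fmap_vertex (s i1 i0) (s i2 i0) (s i2 i1).
elim/I3_case: a ja; elim/I3_case: j => //= _;
  rewrite ?(s i1 i0) ?(s i2 i0) ?(s i2 i1); lra.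
Qed.

Lemma harmonic_ext u v j :
  h (Fword q (u ++ v) (q j)) = ext (fun i => h (Fword q u (q i))) v j.
Proof.
elim: v u => [|a v IH] u; first by rewrite cats0.
rewrite -cat1s catA IH /=; congr (ext _ v j).
by apply/funext => i; rewrite harmonic_subcell.
Qed.

End Harmonic.

End Gasket.

(** * Measure and integration *)

Section PlaneMeasurability.
Variable R : realType.

Lemma open_measurable_prod (A : set (R * R)) : open A -> measurable A.
Proof.
move=> oA.
pose box (a b r : rat) : set (R * R) :=
  `]ratr a - ratr r, ratr a + ratr r[ `*` `]ratr b - ratr r, ratr b + ratr r[.
pose F a b r : set (R * R) := [set z | box a b r z /\ box a b r `<=` A].
have mF a b r : measurable (F a b r).
  have [sub|nsub] := pselect (box a b r `<=` A).
    rewrite (_ : F a b r = box a b r); first exact: measurableX.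
    by apply/seteqP; split=> z; [case|].
  rewrite (_ : F a b r = set0); first exact: measurable0.
  by apply/seteqP; split=> z // [].
rewrite (_ : A = \bigcup_a \bigcup_b \bigcup_r F a b r).
  by do 3 (apply: bigcupT_measurable_rat => ?).
apply/seteqP; split => [z Az|z [a _ [b _ [r _ [bz]]]]]; last exact.
have /nbhs_ballP[e /= e0 be] : nbhs z A by exact: open_nbhs_nbhs.
have e3 : 0 < e / 3 by rewrite divr_gt0.
(* A box of half-width [r] whose centre is within [r] of [z] in each coordinate contains [z] and
   stays within [2 * r < e] of it. *)
have [r] := @rat_in_itvoo R (e / 3) (e / 2) ltac:(lra).
rewrite in_itv /= => /andP[r1 r2].
have [a] := @rat_in_itvoo R (z.1 - ratr r) (z.1 + ratr r) ltac:(lra).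
rewrite in_itv /= => /andP[a1 a2].
have [b] := @rat_in_itvoo R (z.2 - ratr r) (z.2 + ratr r) ltac:(lra).
rewrite in_itv /= => /andP[b1 b2].
exists a => //; exists b => //; exists r => //; split.
  by split; rewrite /= in_itv /=; apply/andP; split; lra.
move=> y [/=]; rewrite !in_itv /= => /andP[h1 h2] /andP[h3 h4]; apply: be.
split; rewrite /ball /= ltr_norml; apply/andP; split; lra.
Qed.

Lemma compact_measurable_prod (A : set (R * R)) : compact A -> measurable A.
Proof.
move/compact_closed => /(_ (@norm_hausdorff _ _)) /closed_openC.
by move/open_measurable_prod/measurableC; rewrite setCK.
Qed.

Lemma within_continuous_measurable_prod (A : set (R * R)) (f : R * R -> R) :
  measurable A -> {within A, continuous f} -> measurable_fun A f.
Proof.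
move=> mA /continuousP cf; apply: (measurability _ (measurable_realfun.RGenOpens.measurableE R)).
move=> _ [_ [a [b ->] <-]].
have /open_subspaceP[V oV VD] : open (f @^-1` `]a, b[ : set (subspace A)).
  exact/cf/interval_open.
by rewrite setIC -VD; apply: measurableI => //; exact: open_measurable_prod.
Qed.

End PlaneMeasurability.

(** * Integration over almost disjoint unions *)

Section AlmostDisjoint.
Context d (T : measurableType d) (R : realType) (mu : {measure set T -> \bar R}).
Hypothesis mu1 : mu setT = 1%E.

Lemma measure_fin A : measurable A -> mu A \is a fin_num.
Proof.
move=> mA; rewrite ge0_fin_numE //; apply: (@le_lt_trans _ _ (mu setT)).
  by apply: le_measure; rewrite ?inE.
by rewrite mu1 ltry.
Qed.

Lemma measure_bigU_null (I : choiceType) (s : seq I) (F : I -> set T) :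
  (forall i, measurable (F i)) -> (forall i, i \in s -> mu (F i) = 0%E) ->
  mu (\big[setU/set0]_(i <- s) F i) = 0%E.
Proof.
move=> mF; elim: s => [|i s IH] F0; first by rewrite big_nil measure0.
rewrite big_cons measureU0 ?F0 ?inE ?eqxx //.
  by apply: bigsetU_measurable.
by apply: IH => j js; rewrite F0 // inE js orbT.
Qed.

Lemma Rintegral_bigU (I : choiceType) (s : seq I) (F : I -> set T) (E : set T) (f : T -> R) :
  measurable E -> mu.-integrable E (EFin \o f) ->
  (forall i, measurable (F i)) -> (forall i, F i `<=` E) -> uniq s ->
  (forall i j, i \in s -> j \in s -> i != j -> mu (F i `&` F j) = 0%E) ->
  Rintegral mu (\big[setU/set0]_(i <- s) F i) f = \sum_(i <- s) Rintegral mu (F i) f.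
Proof.
move=> mE fE mF FE; elim: s => [|i s IH] us F0.
  by rewrite !big_nil Rintegral_set0.
case/andP: us => si us; rewrite !big_cons.
set U := \big[setU/set0]_(j <- s) F j in IH *.
have mU : measurable U by apply: bigsetU_measurable.
have UE : U `<=` E by move=> z; rewrite /U -bigcup_seq => -[j _ /FE].
have iE D : measurable D -> D `<=` E -> mu.-integrable D (EFin \o f).
  by move=> mD DE; exact: integrableS fE.
have -> : F i `|` U = F i `|` (U `\` F i).
  apply/seteqP; split=> z; last by case=> [?|[? _]]; [left|right].
  by case=> [?|Uz]; [left|have [?|?] := pselect (F i z); [left|right]].
rewrite Rintegral_setU //; first last.
- by apply/disj_setPS => z [? []].
- apply: iE; first by apply: measurableU => //; exact: measurableD.
  by move=> z [/FE //|[/UE]].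
- exact: measurableD.
congr (_ + _); rewrite -IH //; last first.
  by move=> j k js ks; apply: F0; rewrite inE ?js ?ks orbT.
rewrite /Rintegral [in RHS](@negligible_integral _ _ _ _ _ (U `&` F i)).
- by rewrite setDIr setDv set0U.
- exact: measurableI.
- exact: mU.
- exact: iE.
- rewrite setIC /U big_distrr /=; apply: measure_bigU_null.
    by move=> j; exact: measurableI.
  move=> j js; apply: F0; rewrite ?inE ?eqxx ?js ?orbT //.
  by apply: contraNneq si => ->.
Qed.

Lemma Rintegral_near_cst (D : set T) (f : T -> R) (c e : R) :
  measurable D -> mu.-integrable D (EFin \o f) ->
  (forall z, D z -> `|f z - c| <= e) ->
  `|Rintegral mu D f - c * fine (mu D)| <= e * fine (mu D).
Proof.
move=> mD fD h.
have ic r : mu.-integrable D (EFin \o (fun=> r)).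
  apply: measurable_bounded_integrable => //.
  - by rewrite -ge0_fin_numE // measure_fin.
  - exact: bounded_cst.
rewrite -!Rintegral_cst // -RintegralB //.
have iB : mu.-integrable D (EFin \o (fun z => f z - c)).
  by have := @integrableB _ _ _ mu D mD _ _ fD (ic c).
apply: le_trans (le_normr_Rintegral mD iB) _.
apply: le_Rintegral => //; first exact: (integrable_norm iB).
Qed.

End AlmostDisjoint.

(** * Integrals over caps as limits of Riemann sums *)

Section GasketIntegral.
Variables (R : realType) (q : 'I_3 -> R * R) (K : set (R * R)).
Variable mu : {measure set (R * R)%type -> \bar R}.
Hypothesis eq_q : equilateral q.
Hypothesis sgK : is_SG q K.
Hypothesis muK : SG_measure q K mu.
Implicit Types (y z : R * R) (k a b : 'I_3) (u v w : seq 'I_3).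

Let cK : compact K. Proof. by case: sgK. Qed.

Lemma Fword_dist v y z :
  (Fword q v y).1 - (Fword q v z).1 = 2 ^- size v * (y.1 - z.1) /\
  (Fword q v y).2 - (Fword q v z).2 = 2 ^- size v * (y.2 - z.2).
Proof.
elim: v => [|a v [IH1 IH2]]; first by rewrite /= expr0 invr1 !mul1r.
rewrite /= -(halfX R) in IH1 IH2 *; split; lra.
Qed.

Lemma Fword_continuous v : continuous (Fword q v).
Proof.
elim: v => [|a v IH] z; first exact: cvg_id.
have h : continuous (Fmap q a).
  move=> y; apply: (@cvg_pair _ _ _ (nbhs y) (nbhs ((y.1 + (q a).1) / 2))
    (nbhs ((y.2 + (q a).2) / 2)) _ _ _ (fun y => (y.1 + (q a).1) / 2)
    (fun y => (y.2 + (q a).2) / 2)).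
    apply: cvgM; last exact: cvg_cst.
    by apply: cvgD; [exact: cvg_fst|exact: cvg_cst].
  apply: cvgM; last exact: cvg_cst.
  by apply: cvgD; [exact: cvg_snd|exact: cvg_cst].
exact: continuous_comp (IH z) (h _).
Qed.

Lemma cell_compact v (A : set (R * R)) : compact A -> compact (Fword q v @` A).
Proof.
by move=> cA; apply: continuous_compact => //; apply/continuous_subspaceT/Fword_continuous.
Qed.

Lemma cell_measurable v : measurable (cell q K v).
Proof. by apply: compact_measurable_prod; exact: cell_compact. Qed.

Lemma cell_sub v : cell q K v `<=` K.
Proof. by move=> _ [z Kz <-]; exact: Fword_K. Qed.

Lemma compact_normr_bound (f : R * R -> R) : {within K, continuous f} ->
  exists2 M, 0 < M & forall z, K z -> `|f z| <= M.
Proof.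
move=> cf; have /ex_strict_bound_gt0[M M0 HM] : bounded_set (f @` K).
  exact/compact_bounded/continuous_compact.
by exists M => // z Kz; apply/ltW/HM; exists z.
Qed.

Lemma gasket_diameter : exists2 D : R, 0 < D & forall y z, K y -> K z ->
  `|y.1 - z.1| <= D /\ `|y.2 - z.2| <= D.
Proof.
have [|M M0 HM] := @compact_normr_bound fst.
  by apply: continuous_subspaceT => z; exact: cvg_fst.
have [|N N0 HN] := @compact_normr_bound snd.
  by apply: continuous_subspaceT => z; exact: cvg_snd.
exists (2 * M + 2 * N); first lra.
move=> y z Ky Kz; split; apply: (le_trans (ler_normB _ _)).
- have := HM _ Ky; have := HM _ Kz; lra.
- have := HN _ Ky; have := HN _ Kz; lra.
Qed.

Lemma geo_half_lt (D e : R) : 0 < D -> 0 < e -> \forall n \near \oo, 2 ^- n * D < e.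
Proof.
move=> D0 e0; have : (fun n => (2^-1 : R) ^+ n * D) @ \oo --> 0 * D.
  by apply: cvgM; [apply: cvg_expr; rewrite ger0_norm; lra|exact: cvg_cst].
rewrite mul0r => /cvgrPdist_lt /(_ e e0); apply: filterS => n.
rewrite sub0r normrN ger0_norm ?exprVn //.
by rewrite mulr_ge0 ?invr_ge0 ?exprn_ge0 // ltW.
Qed.

(** Uniform continuity of [h] on the compact [K], together with the coordinate spread [2 ^- n * D]
    of a cell of level [n]. *)
Lemma cell_oscillation (h : R * R -> R) (e : R) : {within K, continuous h} -> 0 < e ->
  \forall n \near \oo, forall v y z, size v = n -> K y -> K z ->
    `|h (Fword q v y) - h (Fword q v z)| <= e.
Proof.
move=> ch e0; have [D D0 HD] := gasket_diameter.
pose P (n : nat) x := K x -> forall y, K y -> `|x.1 - y.1| <= 2 ^- n * D ->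
  `|x.2 - y.2| <= 2 ^- n * D -> `|h x - h y| <= e.
have : \forall n \near \oo, K `<=` P n.
  have /compact_near_coveringP nc := cK; apply: nc => x Kx.
  have /subspace_continuousP/(_ x Kx)/cvgrPdist_lt/(_ (e / 2)) := ch.
  rewrite divr_gt0 // => /(_ isT); rewrite near_withinE => /nbhs_ballP[r /= r0 xr].
  have r2 : 0 < r / 2 by rewrite divr_gt0.
  exists (ball x (r / 2), [set n | 2 ^- n * D < r / 2]).
    by split; [exact: nbhsx_ballx|exact: geo_half_lt].
  move=> [x' n] /= [[b1 b2] nr] Kx' y Ky h1 h2.
  rewrite /ball /= in b1 b2.
  have hx' : `|h x - h x'| < e / 2.
    by apply: xr => //; split; rewrite /ball /=; lra.
  have hy : `|h x - h y| < e / 2.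
    apply: xr => //; split; rewrite /ball /=.
    - apply: (le_lt_trans (ler_distD x'.1 _ _)); lra.
    - apply: (le_lt_trans (ler_distD x'.2 _ _)); lra.
  apply: (le_trans (ler_distD (h x) _ _)); rewrite (distrC (h x')); lra.
apply: filterS => n H v y z vn Ky Kz; apply: H; try exact: Fword_K.
- rewrite (Fword_dist v y z).1 vn normrM ger0_norm ?invr_ge0 ?exprn_ge0 //.
  by rewrite ler_wpM2l ?invr_ge0 ?exprn_ge0 // (HD y z Ky Kz).1.
- rewrite (Fword_dist v y z).2 vn normrM ger0_norm ?invr_ge0 ?exprn_ge0 //.
  by rewrite ler_wpM2l ?invr_ge0 ?exprn_ge0 // (HD y z Ky Kz).2.
Qed.

Let mu1 : mu setT = 1%E. Proof. by case: muK. Qed.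

Lemma mu_cell v : mu (cell q K v) = (3 ^- size v)%:E.
Proof. by case: muK => _ [_ ->]. Qed.

(** The point lies in a cell of every level [n], of mass [3 ^- n]. *)
Lemma mu_point z : K z -> mu [set z] = 0%E.
Proof.
move=> Kz; have mz : measurable [set z] by apply: compact_measurable_prod; exact: compact_set1.
apply/eqP; rewrite eq_le measure_ge0 andbT; apply/lee_addgt0Pr => e e0; rewrite add0e.
have [n hn] : exists n, (3 ^- n : R) <= e.
  have : (fun n => (3^-1 : R) ^+ n) @ \oo --> 0 by apply: cvg_expr; rewrite ger0_norm; lra.
  move=> /cvgrPdist_le /(_ e e0) [n _ /(_ n (leqnn n))] /= h.
  by exists n; move: h; rewrite sub0r normrN exprVn ger0_norm // invr_ge0 exprn_ge0.
have [u un [y Ky zE]] := K_Fword sgK n Kz.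
apply: (@le_trans _ _ (mu (cell q K u))).
  by apply: le_measure; rewrite ?inE //; [exact: cell_measurable|move=> _ ->; exists y].
by rewrite mu_cell un lee_fin.
Qed.

Lemma cells_ae_disjoint u v : size u = size v -> u <> v ->
  mu (cell q K u `&` cell q K v) = 0%E.
Proof.
move=> suv uv.
have mI : measurable (cell q K u `&` cell q K v) by apply: measurableI; exact: cell_measurable.
have [[z [[y Ky yz] [y' Ky' y'z]]]|] := pselect (cell q K u `&` cell q K v !=set0); last first.
  by move/nonemptyPn => ->; rewrite measure0.
have Kz : K z by rewrite -yz; exact: Fword_K.
apply: (@subset_measure0 _ _ _ _ _ [set z]) => //.
- by apply: compact_measurable_prod; exact: compact_set1.
- move=> _ [[s Ks <-] [s' Ks' E]] /=; rewrite -yz; congr Fword.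
  apply/esym/(cells_meet_uniq eq_q sgK suv uv Ky Ky' Ks Ks'); last exact/esym.
  by rewrite yz y'z.
- exact: mu_point.
Qed.

Lemma gasket_integrable (f : R * R -> R) : {within K, continuous f} ->
  mu.-integrable K (EFin \o f).
Proof.
move=> cf; have mK := compact_measurable_prod cK.
apply: measurable_bounded_integrable => //.
- by rewrite -ge0_fin_numE //; exact: (measure_fin mu1 mK).
- exact: within_continuous_measurable_prod.
- have [M M0 HM] := compact_normr_bound cf.
  exists M; split; first by rewrite num_real.
  by move=> N MN z Kz; apply: le_trans (HM z Kz) (ltW MN).
Qed.

(** Barycentric form of a cap; [Ecap_capset] identifies it with [Ecap] for [t = 1 - c]. *)
Definition capset w k (t : R) : set (R * R) :=
  Fword q w @` (K `&` [set y | t <= bary q k y]).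

Lemma capset_measurable w k t : measurable (capset w k t).
Proof.
apply: compact_measurable_prod; apply: cell_compact; apply: compact_closedI; first exact: cK.
have /continuous_closedP cb := @bary_continuous R q k.
exact: (cb _ (@closed_ge R t)).
Qed.

Lemma capset_sub w k t : capset w k t `<=` K.
Proof. by move=> _ [z [Kz _] <-]; exact: Fword_K. Qed.

Lemma capset_full w k t : t <= 0 -> capset w k t = cell q K w.
Proof.
move=> t0; congr image; apply/seteqP; split=> z; first by case.
by move=> Kz; split=> //=; apply: le_trans t0 _; exact: (bary_ge0 eq_q sgK).
Qed.

Definition capcells w k n (t : R) : set (R * R) :=
  \big[setU/set0]_(v <- [seq v <- words n | t <= low R k v]) cell q K (w ++ v).

Lemma capcellsP w k n t z : capcells w k n t z <->
  exists v, [/\ size v = n, t <= low R k v & cell q K (w ++ v) z].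
Proof.
rewrite /capcells -bigcup_seq; split => [[v /= + ?]|[v [vn tv ?]]].
  by rewrite mem_filter mem_words => /andP[? /eqP]; exists v.
by exists v => //=; rewrite mem_filter mem_words tv vn eqxx.
Qed.

Lemma capcells_measurable w k n t : measurable (capcells w k n t).
Proof. by apply: bigsetU_measurable => v _; exact: cell_measurable. Qed.

Lemma capcells_sub_capset w k n t : capcells w k n t `<=` capset w k t.
Proof.
move=> z /capcellsP[v [vn tv [y Ky <-]]]; rewrite Fword_cat.
exists (Fword q v y) => //; split; first exact: Fword_K.
rewrite /= bary_Fword //; apply: (le_trans tv); rewrite lerDr.
by rewrite mulr_ge0 ?invr_ge0 ?exprn_ge0 //; exact: (bary_ge0 eq_q sgK).
Qed.

Lemma capset_sub_capcells w k n t : capset w k t `<=` capcells w k n (t - 2 ^- n).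
Proof.
move=> _ [y [Ky ty] <-]; have [v vn [z Kz yz]] := K_Fword sgK n Ky.
apply/capcellsP; exists v; split => //; last by exists z; rewrite // Fword_cat -yz.
move: ty; rewrite /= yz bary_Fword // vn => ty.
rewrite lerBlDr (le_trans ty) // addrC lerD2l ler_piMr ?invr_ge0 ?exprn_ge0 //.
exact: (bary_le1 eq_q sgK).
Qed.

Lemma Rintegral_capcells w k n t f : {within K, continuous f} ->
  Rintegral mu (capcells w k n t) f =
  \sum_(v <- words n | t <= low R k v) Rintegral mu (cell q K (w ++ v)) f.
Proof.
move=> cf; rewrite -big_filter /capcells.
apply: (@Rintegral_bigU _ _ _ mu _ _ (fun v => cell q K (w ++ v)) K).
- exact: compact_measurable_prod.
- exact: gasket_integrable.
- by move=> v; exact: cell_measurable.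
- by move=> v; exact: cell_sub.
- by rewrite filter_uniq // uniq_words.
move=> u v; rewrite !mem_filter !mem_words => /andP[_ /eqP un] /andP[_ /eqP vn] uv.
apply: cells_ae_disjoint; first by rewrite !size_cat un vn.
by move=> /eqP; rewrite eqseq_cat // eqxx /= (negbTE uv).
Qed.

Lemma ext_const1 v : ext (fun=> 1 : R) v = fun=> 1.
Proof. by elim: v => //= a v IH; rewrite subcell_const1. Qed.

Lemma mu_capcells w k n t :
  fine (mu (capcells w k n t)) = 3 ^- size w * capsum k n t (fun=> 1).
Proof.
have m := @capcells_measurable w k n t.
transitivity (Rintegral mu (capcells w k n t) (fun=> 1)).
  by rewrite Rintegral_cst // mul1r.
rewrite Rintegral_capcells; last by apply: continuous_subspaceT => z; exact: cvg_cst.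
rewrite capsumE mulrA mulr_sumr big_seq_cond [RHS]big_seq_cond.
apply: eq_bigr => v; rewrite mem_words => /andP[/eqP vn _].
rewrite Rintegral_cst; last exact: cell_measurable.
rewrite mu_cell /= ext_const1 /mean3 big_I3 size_cat vn exprD invfM.
by field; rewrite !expf_neq0.
Qed.

(** On the selected subcells [h] is close to its vertex averages by uniform continuity, and the rest
    of the cap has small mass by the strip estimate. *)
Lemma Rintegral_capset (h : R * R -> R) w k t (x : 'I_3 -> R) :
  {within K, continuous h} ->
  (forall v j, h (Fword q (w ++ v) (q j)) = ext x v j) ->
  (fun n => 3 ^- size w * capsum k n t x) @ \oo --> Rintegral mu (capset w k t) h.
Proof.
move=> ch hx; apply/cvgrPdist_le => /= e e0.
have [M M0 HM] := compact_normr_bound ch.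
have ih := gasket_integrable ch; have mK := compact_measurable_prod cK.
have iD D : measurable D -> D `<=` K -> mu.-integrable D (EFin \o h).
  by move=> mD DK; exact: integrableS ih.
have m3 : 0 < (3 ^- size w : R) by rewrite invr_gt0 exprn_gt0.
have m31 : (3 ^- size w : R) <= 1 by rewrite invf_le1 ?exprn_gt0 // exprn_ege1 // ler1n.
have e2 : 0 < e / 2 by rewrite divr_gt0.
have osc : \forall n \near \oo, forall v y z, size v = (size w + n)%N -> K y -> K z ->
    `|h (Fword q v y) - h (Fword q v z)| <= e / 2.
  have := cell_oscillation ch e2; case=> N _ HN; exists N => // n /= Nn v y z vn.
  by apply: HN vn; rewrite /= (leq_trans Nn) // leq_addl.
have small : \forall n \near \oo, M * (2 / 3) ^+ n <= e / 2.
  have : (fun n => M * (2 / 3 : R) ^+ n) @ \oo --> M * 0.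
    by apply: cvgM; [exact: cvg_cst|apply: cvg_expr; rewrite ger0_norm; lra].
  rewrite mulr0 => /cvgrPdist_le /(_ _ e2); apply: filterS => n.
  by rewrite sub0r normrN; apply: le_trans; exact: ler_norm.
near=> n.
have osc_n : forall v y z, size v = (size w + n)%N -> K y -> K z ->
    `|h (Fword q v y) - h (Fword q v z)| <= e / 2 by near: n.
have small_n : M * (2 / 3) ^+ n <= e / 2 by near: n.
set E := capset w k t; set U := capcells w k n t.
have mE : measurable E by exact: capset_measurable.
have mU : measurable U by exact: capcells_measurable.
have EK : E `<=` K by exact: capset_sub.
have UE : U `<=` E by exact: capcells_sub_capset.
have split_E : Rintegral mu E h = Rintegral mu U h + Rintegral mu (E `\` U) h.
  rewrite -[in LHS](setDUK UE) Rintegral_setU //; first exact: measurableD.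
  - by rewrite setDUK //; exact: iD.
  - by apply/disj_setPS => z [? []].
(* The part missed by the inner cells lies between inner and outer cells; the difference of their
   masses is a strip sum for the constant 1, at most [(2 / 3) ^+ n]. *)
have bound_E : `|Rintegral mu (E `\` U) h| <= e / 2.
  have mD : measurable (E `\` U) by exact: measurableD.
  have := @Rintegral_near_cst _ _ _ mu mu1 _ h 0 M mD (iD _ mD (subset_trans (@subDsetl _ _ _) EK)).
  rewrite mul0r subr0 => /(_ _)/le_trans; apply.
    by move=> z [/EK Kz _]; rewrite subr0; exact: HM.
  apply: le_trans small_n; rewrite ler_wpM2l ?(ltW M0) //.
  set U' := capcells w k n (t - 2 ^- n).
  have mU' : measurable U' by exact: capcells_measurable.
  have UU' : U `<=` U' by apply: subset_trans UE _; exact: capset_sub_capcells.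
  apply: (@le_trans _ _ (fine (mu (U' `\` U)))).
    rewrite fine_le ?(measure_fin mu1) //; first exact: measurableD.
    apply: le_measure; rewrite ?inE //; first exact: measurableD.
    by apply: setSD; exact: capset_sub_capcells.
  rewrite measureD // ?(setIidr UU') ?fineB ?(measure_fin mu1) //; last first.
    by rewrite -ge0_fin_numE // (measure_fin mu1).
  rewrite /U /U' !mu_capcells -mulrBr.
  have s := @capsum_strip R k n t (fun=> 1) (fun=> ler01) (fun=> lexx 1).
  apply: (@le_trans _ _ (1 * (2 / 3) ^+ n)); last by rewrite mul1r.
  apply: ler_pM => //.
  rewrite subr_ge0; apply: capsum_nincr => //.
  by rewrite gerBl invr_ge0 exprn_ge0.
have bound_U : `|Rintegral mu U h - 3 ^- size w * capsum k n t x| <= e / 2.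
  rewrite /U Rintegral_capcells // capsumE mulrA mulr_sumr -sumrB.
  apply: (le_trans (ler_norm_sum _ _ _)).
  apply: (@le_trans _ _ (\sum_(v <- words n | t <= low R k v) e / 2 * (3 ^- size w * 3 ^- n))).
    rewrite big_seq_cond [leRHS]big_seq_cond.
    apply: ler_sum => v; rewrite mem_words => /andP[/eqP vn _].
    have mC := @cell_measurable (w ++ v).
    have := @Rintegral_near_cst _ _ _ mu mu1 _ h (mean3 (ext x v)) (e / 2) mC
      (iD _ mC (@cell_sub (w ++ v))).
    rewrite mu_cell /= size_cat vn exprD invfM [_ * mean3 _]mulrC; apply.
    move=> _ [z Kz <-]; rewrite /mean3.
    have o j : `|h (Fword q (w ++ v) z) - ext x v j| <= e / 2.
      by rewrite -hx; apply: osc_n => //; [rewrite size_cat vn|exact: (vertex_K eq_q sgK)].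
    rewrite big_I3; move: (o i0) (o i1) (o i2); rewrite !ler_norml.
    by move=> /andP[? ?] /andP[? ?] /andP[? ?]; apply/andP; split; lra.
  have -> : \sum_(v <- words n | t <= low R k v) e / 2 * (3 ^- size w * 3 ^- n) =
      e / 2 * (3 ^- size w * capsum k n t (fun=> 1)).
    rewrite capsumE -mulr_sumr; congr (_ * _); rewrite !mulr_sumr; apply: eq_bigr => v _.
    by rewrite ext_const1 /mean3 big_I3; field; rewrite !expf_neq0.
  rewrite ler_piMr ?(ltW e2) // mulr_ile1 ?(ltW m3) //.
    exact: capsum_ge0.
  apply: (le_trans (capsum_le_mean3 _ _ _ _)) => //.
  exact: mean3_le1.
rewrite split_E addrAC; apply: (le_trans (ler_normD _ _)); lra.
Unshelve. all: by end_near. Qed.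

End GasketIntegral.

(** * Caps cut off by lines *)

Section Caps.
Variables (R : realType) (q : 'I_3 -> R * R) (K : set (R * R)).
Variable mu : {measure set (R * R)%type -> \bar R}.
Hypothesis eq_q : equilateral q.
Hypothesis sgK : is_SG q K.
Hypothesis muK : SG_measure q K mu.
Implicit Types (y z : R * R) (k a b : 'I_3) (u v w : seq 'I_3).

Lemma subp_Fword v y z :
  subp (Fword q v y) (Fword q v z) = scalep (2 ^- size v) (subp y z).
Proof. by have [h1 h2] := Fword_dist q v y z; rewrite /subp h1 h2. Qed.

Lemma midp_Fword v y z : midp (Fword q v y) (Fword q v z) = Fword q v (midp y z).
Proof.
elim: v => //= a v <-.
by rewrite /Fmap /midp /=; congr pair; field.
Qed.

Lemma normp_scalep (r : R) z : 0 <= r -> normp (scalep r z) = r * normp z.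
Proof.
move=> r0; rewrite /normp (_ : dotp _ _ = r ^+ 2 * dotp z z).
  by rewrite sqrtrM ?exprn_ge0 // sqrtr_sqr ger0_norm.
by rewrite /dotp /scalep /=; ring.
Qed.

Lemma sq_dist_centroid k :
  dotp (subp (centroid q) (q k)) (subp (centroid q) (q k)) = sqside q / 3.
Proof.
have e01 := @sqside_eq R q eq_q i0 i1 isT; have e12 := @sqside_eq R q eq_q i1 i2 isT.
have e02 := @sqside_eq R q eq_q i0 i2 isT.
move: e01 e12 e02; rewrite /dotp /subp /centroid.
elim/I3_case: k => /=; lra.
Qed.

Lemma sq_height :
  let v := subp (q i0) (midp (q i1) (q i2)) in dotp v v = 3 / 4 * sqside q.
Proof.
have e01 := @sqside_eq R q eq_q i0 i1 isT; have e12 := @sqside_eq R q eq_q i1 i2 isT.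
have e02 := @sqside_eq R q eq_q i0 i2 isT.
move: e01 e12 e02; rewrite /dotp /subp /midp /=; lra.
Qed.

Lemma dotp_axis k y :
  dotp (subp y (q k)) (subp (centroid q) (q k)) = sqside q / 2 * (1 - bary q k y).
Proof.
have d0 : sqside q != 0 by rewrite gt_eqF // sqside_gt0.
have := sq_dist_centroid k; rewrite /bary.
have -> : sqside q / 2 * (1 - (1 / 3 + 2 / sqside q *
    dotp (subp y (centroid q)) (subp (q k) (centroid q)))) =
    sqside q / 3 - dotp (subp y (centroid q)) (subp (q k) (centroid q)) by field.
rewrite /dotp /subp /=; lra.
Qed.

(** Before scaling, the height [H] and the distance [G] from a vertex to the centroid satisfy
    [H * G = sqside q / 2]. By [dotp_axis] the distance along the axis is thus [H] times one minus
    the coordinate, and the scale factor cancels. *)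
Lemma Ecap_capset w w' i k c : size w' = size w ->
  Fword q w (q i) = Fword q w' (q k) ->
  Ecap q K w' (Fword q w (q i)) c (height q w) = capset q K w' k (1 - c).
Proof.
move=> sw e; rewrite /Ecap /height /cell /capset e.
have d0 := sqside_gt0 eq_q.
have m0 : 0 < (2 ^- size w : R) by rewrite invr_gt0 exprn_gt0.
pose G := normp (subp (centroid q) (q k)).
pose H := normp (subp (q i0) (midp (q i1) (q i2))).
have GE : G = Num.sqrt (sqside q / 3) by rewrite /G /normp sq_dist_centroid.
have HE : H = Num.sqrt (3 / 4 * sqside q) by rewrite /H /normp sq_height.
have G0 : 0 < G by rewrite GE sqrtr_gt0 divr_gt0.
have HG : H * G = sqside q / 2.
  rewrite HE GE -sqrtrM; last by rewrite mulr_ge0 // ltW.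
  rewrite (_ : 3 / 4 * _ * _ = (sqside q / 2) ^+ 2); last by field.
  by rewrite sqrtr_sqr ger0_norm // divr_ge0 // ltW.
rewrite midp_Fword !subp_Fword sw !normp_scalep ?(ltW m0) // -/G -/H.
have key y : (dotp (subp (Fword q w' y) (Fword q w' (q k)))
   (scalep (2 ^- size w * G)^-1 (scalep (2 ^- size w) (subp (centroid q) (q k))))
   <= c * (2 ^- size w * H)) = (1 - c <= bary q k y).
  rewrite subp_Fword sw.
  have -> : dotp (scalep (2 ^- size w) (subp y (q k)))
     (scalep (2 ^- size w * G)^-1 (scalep (2 ^- size w) (subp (centroid q) (q k)))) =
     2 ^- size w * (dotp (subp y (q k)) (subp (centroid q) (q k)) / G).
    rewrite /dotp /scalep /=; field.
    by rewrite gt_eqF ?expf_neq0.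
  rewrite [c * _]mulrCA ler_pM2l // dotp_axis ler_pdivrMr //.
  rewrite -[c * _ * _]mulrA HG [c * _]mulrC ler_pM2l ?divr_gt0 //.
  by rewrite lerBlDr addrC -lerBlDr.
apply/seteqP; split => [z [[y Ky <-]]|z [y [Ky yc] <-]].
  by rewrite /= key => yc; exists y.
by split; [exists y|rewrite /= key].
Qed.

(* [cap (fun=> 1)] is the relative mass of a cap, and [cap unit1] the weight that
   its integral gives to each of the two vertices not contained in it. *)
Lemma Rintegral_capset_cap (h : R * R -> R) w k t :
  {within K, continuous h} ->
  (forall v j, h (Fword q (w ++ v) (q j)) = ext (fun j => h (Fword q w (q j))) v j) ->
  Rintegral mu (capset q K w k t) h =
  3 ^- size w * (cap (fun=> 1) t * h (Fword q w (q k)) +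
    cap (@unit1 R) t * (\sum_j h (Fword q w (q j)) - 3 * h (Fword q w (q k)))).
Proof.
move=> ch hx; have L := @Rintegral_capset _ _ _ mu eq_q sgK muK h w k t _ ch hx.
symmetry; apply: (cvg_unique _ _ L) => //.
rewrite (_ : (fun n => _) = (fun n => 3 ^- size w *
  (capsum i0 n t (fun=> 1) * h (Fword q w (q k)) + capsum i0 n t (@unit1 R) *
     (\sum_j h (Fword q w (q j)) - 3 * h (Fword q w (q k)))))); last first.
  by apply/funext => n; rewrite (capsum_linear k).
apply: cvgM; first exact: cvg_cst.
apply: cvgD; (apply: cvgM; last exact: cvg_cst).
  exact: capsum_cvg.
by apply: capsum_cvg => j; rewrite /unit1; case: eqP.
Qed.

End Caps.

(** * The mean value over a cell with three caps *)

Theorem theorem3p1 (R : realType) (q : 'I_3 -> R * R) (K : set (R * R))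
  (mu : {measure set (R * R)%type -> \bar R}) :
  equilateral q -> is_SG q K -> SG_measure q K mu ->
  forall w : seq 'I_3, (forall i : 'I_3, ~ cell q K w (q i)) ->
  forall w' : 'I_3 -> seq 'I_3,
    (forall i : 'I_3, size (w' i) = size w /\ w' i <> w /\
                      cell q K (w' i) (Fword q w (q i))) ->
  forall a : 'I_3 -> R, (forall i, 0 <= a i) -> \sum_i a i = 1 ->
  exists c : 'I_3 -> R, (forall i, 0 <= c i <= 1) /\
    forall h : R * R -> R, SG_harmonic q K h ->
      meanval mu (Bset q K w w' c) h = \sum_i a i * h (Fword q w (q i)).
Proof.
move=> eq_q sgK muK w _ w' Hw' a a0 a1.
have vK i : K (q i) := vertex_K eq_q sgK i.
have sw i : size (w' i) = size w by case: (Hw' i).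
have nw i : w <> w' i by move=> e; case: (Hw' i) => _ [/(_ (esym e))].
(* Distinct cells of one level only meet at vertices, so [p_i] is also a vertex of its adjacent
   cell. *)
have kex i : exists k, Fword q w (q i) = Fword q (w' i) (q k).
  have [_ [_ [z Kz zE]]] := Hw' i.
  have [k zk] := cells_meet_vertex eq_q sgK (esym (sw i)) (nw i) (vK i) Kz (esym zE).
  by exists k; rewrite -zE zk.
have [k kE] := choice kex.
(* Were two adjacent cells equal, they would share two points with the cell of [w], against
   [cells_meet_uniq]. *)
have w'_inj : injective w'.
  move=> i j ij; apply: (vertex_inj eq_q).
  apply: (cells_meet_uniq eq_q sgK (esym (sw i)) (nw i) (vK i) (vK (k i)) (vK j) (vK (k j))) => //.
  by rewrite ij.
pose e (c : R) := cap (fun=> 1) (1 - c); pose b (c : R) := cap (@unit1 R) (1 - c).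
have u0 j : 0 <= @unit1 R j by rewrite /unit1; case: eqP.
have u1 j : @unit1 R j <= 1 by rewrite /unit1; case: eqP.
have cB : continuous (fun c : R => 1 - c).
  by move=> c; apply: cvgB; [exact: cvg_cst|exact: cvg_id].
have ce : continuous e.
  move=> c; apply: (continuous_comp (cB c)).
  by apply: (@cap_continuous R (fun=> 1)) => // j; exact: ler01.
have cb : continuous b.
  move=> c; apply: (continuous_comp (cB c)); exact: (cap_continuous u0 u1).
have he : {homo e : x y / x <= y}.
  by move=> x y xy; apply: cap_nincr => //; lra.
have hb : {homo b : x y / x <= y}.
  by move=> x y xy; apply: cap_nincr => //; lra.
have e_0 : e 0 = 0 by rewrite /e cap_empty // subr0.
have b_0 : b 0 = 0 by rewrite /b cap_empty // subr0.
have e_1 : e 1 = 1 by rewrite /e subrr cap_full // /mean3 big_I3; field.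
have b_1 : b 1 = 1 / 3 by rewrite /b subrr cap_full // /mean3 big_I3 /unit1 /=; field.
have [x [y [z [x01 y01 z01 [Ex Ey Ez]]]]] := balanced_exists ce cb he hb e_0 e_1 b_0 b_1
  (a0 i0) (a0 i1) (a0 i2) ltac:(by rewrite -big_I3).
pose c i : R := if i == i0 then x else if i == i1 then y else z.
exists c; split; first by elim/I3_case.
(* [None] indexes the central cell and [Some i] the cap at [p_i]; [W] gives the word of the cell
   containing the piece, and distinct pieces lie in distinct cells of one level. *)
pose W (o : option 'I_3) := if o is Some i then w' i else w.
pose F (o : option 'I_3) :=
  if o is Some i then capset q K (w' i) (k i) (1 - c i) else cell q K w.
have FW o : F o `<=` cell q K (W o).
  by case: o => [i|//] _ [s [Ks _] <-]; exists s.
have mF o : measurable (F o).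
  by case: o => [i|]; [exact: capset_measurable|exact: cell_measurable].
have sW o : size (W o) = size w by case: o => [i|] //=; rewrite sw.
have W_inj : injective W.
  move=> [i|] [j|] //=; [by move/w'_inj ->|by move/esym/nw|by move/nw].
pose s : seq (option 'I_3) := None :: [seq Some i | i <- enum 'I_3].
have BE : Bset q K w w' c = \big[setU/set0]_(o <- s) F o.
  rewrite big_cons big_map /Bset; congr setU; rewrite -bigcup_seq.
  apply/seteqP; split => t [i _].
    by rewrite (Ecap_capset K eq_q _ (sw i) (kE i)) => h; exists i => //=; rewrite mem_enum.
  by move=> h; exists i => //; rewrite (Ecap_capset K eq_q _ (sw i) (kE i)).
have RB f : {within K, continuous f} ->
    Rintegral mu (Bset q K w w' c) f = Rintegral mu (cell q K w) f +
      \sum_i Rintegral mu (F (Some i)) f.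
  move=> cf; rewrite BE (@Rintegral_bigU _ _ _ mu _ s F K f) //.
  - by rewrite big_cons big_map big_enum.
  - by apply: compact_measurable_prod; case: sgK.
  - exact: (gasket_integrable sgK muK).
  - by move=> o; apply: subset_trans (FW o) _; exact: cell_sub.
  - rewrite cons_uniq map_inj_uniq ?enum_uniq ?andbT; last by move=> ? ? [].
    by apply/mapP => -[].
  move=> o p _ _ op; apply: (@subset_measure0 _ _ _ _ _ (cell q K (W o) `&` cell q K (W p))).
  - exact: measurableI.
  - by apply: measurableI; exact: cell_measurable.
  - by move=> t [/FW ? /FW ?].
  - by apply: (cells_ae_disjoint eq_q sgK muK); rewrite ?sW // => /W_inj /eqP; rewrite (negbTE op).
have mu1 : fine (mu (Bset q K w w' c)) = 3 ^- size w * (1 + e x + e y + e z).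
  have mB : measurable (Bset q K w w' c) by rewrite BE; exact: bigsetU_measurable.
  have c1 : {within K, continuous (fun=> 1 : R)}.
    by apply: continuous_subspaceT => t; exact: cvg_cst.
  transitivity (Rintegral mu (Bset q K w w' c) (fun=> 1)).
    by rewrite Rintegral_cst // mul1r.
  (* The central cell is a cap of threshold 0, and a mass is the integral of the constant 1, so the
     cap formula yields all masses. *)
  rewrite RB // -(@capset_full _ q K eq_q sgK w i0 0 (lexx _)) big_I3 /F.
  rewrite !(Rintegral_capset_cap eq_q sgK muK) //; try by move=> v j; rewrite ext_const1.
  rewrite !sw !big_I3 -/(e (c i0)) -/(e (c i1)) -/(e (c i2)) /c /=.
  by rewrite cap_full // /mean3 big_I3; field; rewrite expf_neq0.
move=> h hh; have ch := hh.1.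
rewrite /meanval -/(Rintegral mu _ h) mu1 RB //.
set S := \sum_j h (Fword q w (q j)).
have capE i : Rintegral mu (F (Some i)) h =
    3 ^- size w * (e (c i) * h (Fword q w (q i)) + b (c i) * (3 * h (Fword q w (q i)) - S)).
  rewrite /F (Rintegral_capset_cap eq_q sgK muK) //; last first.
    by move=> v j; rewrite (harmonic_ext eq_q sgK hh).
  (* If [S'] is the vertex sum of the adjacent cell, harmonicity at [p_i] gives [6 * H i = S + S'],
     so [S' - 3 * H i = 3 * H i - S]. *)
  have := harmonic_shared eq_q sgK hh (esym (sw i)) (nw i) (kE i).
  rewrite -/S -kE sw => h6; rewrite -/(e (c i)) -/(b (c i)); congr (_ * (_ + _ * _)).
  lra.
have cellE : Rintegral mu (cell q K w) h = 3 ^- size w * (S / 3).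
  rewrite -(@capset_full _ q K eq_q sgK w i0 0 (lexx _)).
  rewrite (Rintegral_capset_cap eq_q sgK muK) //; last first.
    by move=> v j; rewrite (harmonic_ext eq_q sgK hh).
  by rewrite -/S !cap_full // /mean3 !big_I3 /unit1 /=; field; rewrite expf_neq0.
rewrite cellE (eq_bigr _ (fun i _ => capE i)) -mulr_sumr -mulrDr.
have m0 : (3 ^- size w : R) != 0 by rewrite invr_neq0 // expf_neq0.
rewrite -mulf_div divff // mul1r.
have T0 : 1 + e x + e y + e z != 0.
  have := he 0 x; have := he 0 y; have := he 0 z; rewrite e_0.
  case/andP: x01 => -> _; case/andP: y01 => -> _; case/andP: z01 => -> _.
  by move=> /(_ isT) ? /(_ isT) ? /(_ isT) ?; rewrite gt_eqF //; lra.
apply: (mulIf T0); rewrite divfK // /S !big_I3 /c /=.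
set h0 := h (Fword q w (q i0)); set h1 := h (Fword q w (q i1)).
set h2 := h (Fword q w (q i2)); set T := 1 + e x + e y + e z in Ex Ey Ez *.
transitivity (a i0 * T * h0 + a i1 * T * h1 + a i2 * T * h2); last by ring.
by rewrite -Ex -Ey -Ez; field.
Qed.
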